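(* Let $n\ge 2$, $m\ge 1$, and let $f:\mathcal{SO}_n\to\mathbb{R}$ be one of the following cost functions: (a) $f(Q)=\sum_{\ell=1}^{m}\sum_{j=1}^{n}\Big(\sum_{p,q,r=1}^{n}\mathcal{A}^{(\ell)}_{pqr}Q_{pj}Q_{qj}Q_{rj}\Big)^2$, where $\mathcal{A}^{(1)},\dots,\mathcal{A}^{(m)}\in\mathbb{R}^{n\times n\times n}$ are symmetric third-order tensors; or (b) $f(Q)=\sum_{\ell=1}^{m}\|\mathrm{diag}(Q^{\mathsf T}A^{(\ell)}Q)\|^2$, where $A^{(1)},\dots,A^{(m)}\in\mathbb{R}^{n\times n}$ are symmetric matrices. Let $0<\varepsilon\le 2/n$. Then, for any starting point $Q_0\in\mathcal{SO}_n$, every sequence $\{Q_k\}_{k\ge 1}$ produced by the Jacobi-G algorithm applied to $f$ with parameter $\varepsilon$ and starting point $Q_0$ converges to a stationary point of $f$ in $\mathcal{O}_n$.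
   Context: $\mathcal{O}_n\subset\mathbb{R}^{n\times n}$ is the orthogonal group, $\mathcal{SO}_n$ its subgroup of matrices with determinant $1$; $\|\cdot\|$ is the Frobenius/Euclidean norm, $\langle\cdot,\cdot\rangle$ the corresponding inner product, and $\mathrm{diag}(M)$ the vector of diagonal entries of $M$. A tensor is symmetric if its entries are invariant under all permutations of the indices. Givens rotation: for $1\le i<j\le n$ and $\theta\in\mathbb{R}$, $G^{(i,j,\theta)}$ is the $n\times n$ matrix equal to the identity except that its $(i,i)$ and $(j,j)$ entries are $\cos\theta$, its $(j,i)$ entry is $\sin\theta$, and its $(i,j)$ entry is $-\sin\theta$. Let $\delta_{i,j}=\frac{d}{d\theta}G^{(i,j,\theta)}|_{\theta=0}$ (entry $-1$ at $(i,j)$, entry $1$ at $(j,i)$, zero elsewhere) and $d_{i,j}(Q)=Q\delta_{i,j}$. Projected gradient: $\mathrm{Proj}\nabla f(Q)=Q\Lambda(Q)$ with $\Lambda(Q)=\tfrac12\big(Q^{\mathsf T}\nabla f(Q)-(\nabla f(Q))^{\mathsf T}Q\big)$, where $\nabla f$ is the Euclidean gradient of $f$ as a function of the matrix argument (given by the same polynomial formula on $\mathbb{R}^{n\times n}$). A point $Q$ is a stationary point of $f$ if $\mathrm{Proj}\nabla f(Q)=0$. Jacobi-G algorithm (parameter $\varepsilon$, starting point $Q_0$, run without stopping): for $k=1,2,\dots$, (1) choose a pair $(i_k,j_k)$, $i_k<j_k$, such that $|\langle \mathrm{Proj}\nabla f(Q_{k-1}),d_{i_k,j_k}(Q_{k-1})\rangle|\ge\varepsilon\|\mathrm{Proj}\nabla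 f(Q_{k-1})\|$ (any such pair; one always exists when $0<\varepsilon\le 2/n$); (2) compute $\theta_k^*$ maximizing $h_k(\theta)=f(Q_{k-1}G^{(i_k,j_k,\theta)})$ over $\theta\in\mathbb{R}$; if there are several maximizers, one of smallest magnitude is chosen (since $h_k$ is $\pi/2$-periodic here, $\theta_k^*\in[-\pi/4,\pi/4]$); (3) set $Q_k=Q_{k-1}G^{(i_k,j_k,\theta_k^* )}$. *)

(* Defs.v *)
From HB Require Import structures.
From mathcomp Require Import all_boot all_order all_algebra all_fingroup.
From mathcomp Require Import all_classical all_reals all_analysis.

Set Implicit Arguments.
Unset Strict Implicit.
Unset Printing Implicit Defensive.

Import Order.TTheory GRing.Theory Num.Theory.
Import numFieldNormedType.Exports.

Local Open Scope classical_set_scope.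
Local Open Scope ring_scope.

(* The library norm on 'M[R]_(m, n) is the maximum norm, hence the Frobenius
   norm below; the library topology is the Euclidean one, and is used for
   limits and derivatives. *)

Section Euclidean.
Variables (R : realType) (m n : nat).
Implicit Types M N : 'M[R]_(m, n).

Definition frob_dot M N : R := \sum_(i < m) \sum_(j < n) M i j * N i j.

Definition frob_norm M : R := Num.sqrt (frob_dot M M).

End Euclidean.

Section Defs.
Variables (R : realType) (n : nat).
Implicit Types (Q M : 'M[R]_n) (f : 'M[R]_n -> R).

Definition On : set 'M[R]_n := [set Q | Q^T *m Q = 1%:M].

Definition SOn : set 'M[R]_n := [set Q | On Q /\ \det Q = 1].

Definition diag_vec M : 'rV[R]_n := \row_j M j j.

Definition tensor3 := 'I_n -> 'I_n -> 'I_n -> R.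

Definition symmetric3 (A : tensor3) : Prop :=
  forall (s : 'S_3) (p : 'I_3 -> 'I_n),
    A (p (s 0)) (p (s 1)) (p (s 2)) = A (p 0) (p 1) (p 2).

(* The cost functions are polynomials on the whole matrix space, so that they
   have a Euclidean gradient. *)
Definition cost_tensor m (A : 'I_m -> tensor3) Q : R :=
  \sum_(l < m) \sum_(j < n)
    (\sum_(p < n) \sum_(q < n) \sum_(r < n)
        A l p q r * Q p j * Q q j * Q r j) ^+ 2.

Definition cost_matrix m (A : 'I_m -> 'M[R]_n) Q : R :=
  \sum_(l < m) frob_norm (diag_vec (Q^T *m A l *m Q)) ^+ 2.

Definition givens (i j : 'I_n) (t : R) : 'M[R]_n :=
  \matrix_(p, q)
    if (p == i) && (q == i) then cos t
    else if (p == j) && (q == j) then cos t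
    else if (p == j) && (q == i) then sin t
    else if (p == i) && (q == j) then - sin t
    else (p == q)%:R.

Definition delta_givens (i j : 'I_n) : 'M[R]_n := derive1 (givens i j) 0.

Definition tangent_dir (i j : 'I_n) Q : 'M[R]_n := Q *m delta_givens i j.

Definition egrad f Q : 'M[R]_n := \matrix_(i, j) 'D_(delta_mx i j) f Q.

Definition Lambda f Q : 'M[R]_n :=
  2^-1 *: (Q^T *m egrad f Q - (egrad f Q)^T *m Q).

Definition proj_grad f Q : 'M[R]_n := Q *m Lambda f Q.

Definition stationary f Q : Prop := proj_grad f Q = 0.

Definition maximizer (h : R -> R) (t : R) : Prop := forall u, h u <= h t.

Definition smallest_maximizer (h : R -> R) (t : R) : Prop :=
  maximizer h t /\ forall u, maximizer h u -> `|t| <= `|u|.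

Definition jacobiG_step f (eps : R) Q Q' : Prop :=
  exists (i j : 'I_n) (t : R),
    [/\ (i < j)%N,
        eps * frob_norm (proj_grad f Q)
          <= `|frob_dot (proj_grad f Q) (tangent_dir i j Q)|,
        smallest_maximizer (fun u => f (Q *m givens i j u)) t
      & Q' = Q *m givens i j t].

(* The choices of pair and of maximizer are left free, so this characterizes
   all the sequences the algorithm may produce. *)
Definition jacobiG f (eps : R) Q0 (Q : nat -> 'M[R]_n) : Prop :=
  Q 0%N = Q0 /\ forall k, jacobiG_step f eps (Q k) (Q k.+1).

Lemma delta_givensE (i j : 'I_n) : (i < j)%N ->
  delta_givens i j = delta_mx j i - delta_mx i j.
Proof.
move=> lt_ij.
have nij : (i == j) = false by apply/eqP => e; rewrite e ltnn in lt_ij.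
have nji : (j == i) = false by rewrite eq_sym.
have D p q : is_derive (0 : R) (1 : R) (fun t => givens i j t p q)
    ((delta_mx j i - delta_mx i j : 'M[R]_n) p q).
  under eq_fun do rewrite mxE.
  rewrite !mxE.
  have [->|pi] := eqVneq p i; have [->|qi] := eqVneq q i;
    rewrite ?nij ?nji ?eqxx /=.
  - by rewrite subr0; apply: is_derive_eq; rewrite sin0 oppr0.
  - case: eqVneq => _; last by rewrite subr0; exact: is_derive_cst.
    by apply: is_derive_eq; rewrite cos0 sub0r.
  - rewrite andbF andbT subr0.
    case: eqVneq => _; last by rewrite (negPf pi); exact: is_derive_cst.
    by apply: is_derive_eq; rewrite cos0.
  - rewrite !andbF subr0; case: andP => _; last exact: is_derive_cst.
    by apply: is_derive_eq; rewrite sin0 oppr0.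
have dG : derivable (givens i j) 0 1.
  by apply/derivable_mxP => p q; have [] := D p q.
rewrite /delta_givens derive1E derive_mx//; apply/matrixP => p q.
by rewrite mxE; have [_ ->] := D p q.
Qed.

End Defs.

(* Main.v *)
Require Import Defs.
From mathcomp Require Import all_boot all_order all_algebra all_fingroup.
From mathcomp Require Import all_classical all_reals all_analysis.
From mathcomp Require ordered_qelim qe_rcf.
From mathcomp Require Import ring lra.
Import Order.TTheory GRing.Theory Num.Theory.
Import numFieldNormedType.Exports.
Local Open Scope classical_set_scope.
Local Open Scope ring_scope.

Set Implicit Arguments.
Unset Strict Implicit.
Unset Printing Implicit Defensive.

(**
A Jacobi rotation through the angle t changes the cost by a trigonometric
polynomial of degree one in 4t. Maximizing it, and using that the slope at 0 is
at least eps |Proj grad f|, gives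
  kappa |Proj grad f(Q_k)| |Q_(k+1) - Q_k| <= f(Q_(k+1)) - f(Q_k).
Summability of the steps then needs a Lojasiewicz-type inequality. Let c be the
limit of f(Q_k). By Tarski-Seidenberg, minimizers g(t) of |Proj grad f| on the
level sets {Q in O_n : f(Q) = c - t} can be chosen with semialgebraic entries,
which are monotone for small t > 0. If V(t) is the sum of these entries, with
signs that make all of them nondecreasing, then Taylor's formula along a fine
partition gives, for 0 < a < b small and f(Q) = c - b,
  b - a <= |Proj grad f(Q)| (V(b) - V(a)).
With a = c - f(Q_(k+1)) and b = c - f(Q_k), the steps |Q_(k+1) - Q_k| are
bounded by a constant times the decrements of the bounded monotone sequence
V(c - f(Q_k)).
*)

(** The obstacle is that the curve [g] of minimizers is only semialgebraic: neither continuity nor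
    differentiability of it is at hand, so nothing can be integrated along it. Monotone entries
    replace arc length: for s < t the absolute increments of the entries of [g] add up to exactly
    V(t) - V(s), which controls both the linear and the quadratic term of Taylor's formula between
    g(t) and g(s). Minimizing over whole level sets makes the gradient bound at g(b) valid for every
    Q of level c - b, so no neighbourhood of an accumulation point has to be singled out. Between a
    and b the gradient along [g] is bounded by its value at b. This uses that its norm is itself
    semialgebraic, hence monotone near 0; if it is nonincreasing it vanishes, because iterates with
    arbitrarily small gradient occur at levels arbitrarily close to c. The rotation also yields
    |Proj grad f(Q_k)|^2 <= const (f(Q_(k+1)) - f(Q_k)), which drives the gradient to 0 and makes
    the limit stationary. Taking a maximizer of smallest magnitude forces Q_(k+1) = Q_k when the
    cost does not grow, so that the sequence cannot drift inside a level set. *)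

(** * Polynomial functions in an arbitrary family of coordinates *)

Section PolynomialFunctions.
Variable R : realType.

(** The coordinates [X] are a parameter so that one notion serves both the variables of logical
    formulas and the entries of a matrix; [polyfun_comp] passes from one to the other. *)
Inductive polyfun (E I : Type) (X : I -> E -> R) : (E -> R) -> Prop :=
| polyfun_coord i : polyfun X (X i)
| polyfun_const c : polyfun X (fun=> c)
| polyfunD p q : polyfun X p -> polyfun X q -> polyfun X (fun e => p e + q e)
| polyfunM p q : polyfun X p -> polyfun X q -> polyfun X (fun e => p e * q e).

Lemma polyfunN (E I : Type) (X : I -> E -> R) p :
  polyfun X p -> polyfun X (fun e => - p e).
Proof.
move=> pp; rewrite (_ : (fun e => - p e) = (fun e => -1 * p e)).
  by apply: polyfunM => //; exact: polyfun_const.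
by apply/funext => e; rewrite mulN1r.
Qed.

Lemma polyfunB (E I : Type) (X : I -> E -> R) p q :
  polyfun X p -> polyfun X q -> polyfun X (fun e => p e - q e).
Proof. by move=> pp pq; apply: polyfunD => //; exact: polyfunN. Qed.

Lemma polyfunX (E I : Type) (X : I -> E -> R) p k :
  polyfun X p -> polyfun X (fun e => p e ^+ k).
Proof.
move=> pp; elim: k => [|k ih].
  by under eq_fun do rewrite expr0; exact: polyfun_const.
by under eq_fun do rewrite exprS; exact: polyfunM.
Qed.

Lemma polyfun_sum (E I J : Type) (X : I -> E -> R) (r : seq J) (P : pred J)
    (p : J -> E -> R) :
  (forall j, P j -> polyfun X (p j)) ->
  polyfun X (fun e => \sum_(j <- r | P j) p j e).
Proof.
move=> pp; elim: r => [|j r ih].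
  by under eq_fun do rewrite big_nil; exact: polyfun_const.
under eq_fun do rewrite big_cons.
have [Pj|_] := boolP (P j); last exact: ih.
by apply: polyfunD => //; exact: pp.
Qed.

Lemma polyfun_comp (E F I J : Type) (X : I -> E -> R) (Y : J -> F -> R)
    (s : F -> E) p :
  (forall i, polyfun Y (fun x => X i (s x))) -> polyfun X p ->
  polyfun Y (fun x => p (s x)).
Proof.
move=> sY; elim => [i|c|p1 q1 _ h1 _ h2|p1 q1 _ h1 _ h2].
- exact: sY.
- exact: polyfun_const.
- exact: polyfunD.
- exact: polyfunM.
Qed.

End PolynomialFunctions.

(** * Semialgebraic predicates and quantifier elimination *)

Section Semialgebraic.
Variable R : realType.

Definition var (i : nat) (x : nat -> R) := x i.

(** Points are infinite sequences, so no arity has to be tracked. Arbitrary real constants may occur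
    in the polynomials, so that real parameters, such as the limit value of the cost, are
    allowed. *)
Inductive semialg : ((nat -> R) -> Prop) -> Prop :=
| semialg_gt0 p : polyfun var p -> semialg (fun x => 0 < p x)
| semialg_not P : semialg P -> semialg (fun x => ~ P x)
| semialg_and P Q : semialg P -> semialg Q -> semialg (fun x => P x /\ Q x).

Lemma semialg_ext P Q : (forall x, P x <-> Q x) -> semialg P -> semialg Q.
Proof.
by move=> PQ; rewrite (_ : P = Q)//; apply/funext => x; exact/propext.
Qed.

Lemma semialg_or P Q :
  semialg P -> semialg Q -> semialg (fun x => P x \/ Q x).
Proof.
move=> hP hQ.
apply: (@semialg_ext (fun x => ~ (~ P x /\ ~ Q x))).
  by move=> x; rewrite not_andP !notK.
by apply/semialg_not/semialg_and; exact: semialg_not.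
Qed.

Lemma semialg_imp P Q :
  semialg P -> semialg Q -> semialg (fun x => P x -> Q x).
Proof.
move=> hP hQ; apply: (@semialg_ext (fun x => ~ P x \/ Q x)).
  by move=> x; rewrite implyE.
by apply: semialg_or => //; exact: semialg_not.
Qed.

Lemma semialg_lt p q : polyfun var p -> polyfun var q ->
  semialg (fun x => p x < q x).
Proof.
move=> pp pq; apply: (@semialg_ext (fun x => 0 < q x - p x)).
  by move=> x; rewrite subr_gt0.
by apply: semialg_gt0; exact: polyfunB.
Qed.

Lemma semialg_le p q : polyfun var p -> polyfun var q ->
  semialg (fun x => p x <= q x).
Proof.
move=> pp pq; apply: (@semialg_ext (fun x => ~ (q x < p x))).
  by move=> x; rewrite leNgt; split => /negP.
by apply: semialg_not; exact: semialg_lt.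
Qed.

Lemma semialg_eq p q : polyfun var p -> polyfun var q ->
  semialg (fun x => p x = q x).
Proof.
move=> pp pq; apply: (@semialg_ext (fun x => p x <= q x /\ q x <= p x)).
  move=> x; split=> [[h1 h2]|->//].
  by apply/le_anti; rewrite h1 h2.
by apply: semialg_and; exact: semialg_le.
Qed.

Lemma semialg_const (A : Prop) : semialg (fun=> A).
Proof.
apply: (@semialg_ext (fun x => (0 : R) < (if `[< A >] then 1 else 0))).
  by move=> _; case: asboolP => h; rewrite ?ltr01 ?ltxx.
by apply: semialg_lt; exact: polyfun_const.
Qed.

Lemma semialg_comp P (s : (nat -> R) -> nat -> R) :
  (forall i, polyfun var (fun x => s x i)) -> semialg P ->
  semialg (fun x => P (s x)).
Proof.
move=> ps; elim => [p pp|P1 _ h|P1 P2 _ h1 _ h2].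
- by apply: semialg_gt0; exact: polyfun_comp pp.
- exact: semialg_not.
- exact: semialg_and.
Qed.

Lemma polyfun_finsupp p : polyfun var p ->
  exists N, forall x y, (forall i, (i < N)%N -> x i = y i) -> p x = p y.
Proof.
elim => [i|c|p1 p2 _ [N1 h1] _ [N2 h2]|p1 p2 _ [N1 h1] _ [N2 h2]].
- by exists i.+1 => x y xy; exact: xy.
- by exists 0%N.
- exists (maxn N1 N2) => x y xy; rewrite (h1 x y) ?(h2 x y)//.
    by move=> i iN; apply: xy; rewrite leq_max iN orbT.
  by move=> i iN; apply: xy; rewrite leq_max iN.
- exists (maxn N1 N2) => x y xy; rewrite (h1 x y) ?(h2 x y)//.
    by move=> i iN; apply: xy; rewrite leq_max iN orbT.
  by move=> i iN; apply: xy; rewrite leq_max iN.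
Qed.

(** Needed to replace the infinite sequence by a finite list, which is what formulas are evaluated
    on. *)
Lemma semialg_finsupp P : semialg P ->
  exists N, forall x y, (forall i, (i < N)%N -> x i = y i) -> P x = P y.
Proof.
elim => [p /polyfun_finsupp[N h]|P1 _ [N h]|P1 P2 _ [N1 h1] _ [N2 h2]].
- by exists N => x y xy; rewrite (h x y).
- by exists N => x y xy; rewrite (h x y).
- exists (maxn N1 N2) => x y xy; rewrite (h1 x y) ?(h2 x y)//.
    by move=> i iN; apply: xy; rewrite leq_max iN orbT.
  by move=> i iN; apply: xy; rewrite leq_max iN.
Qed.

Lemma polyfun_term p : polyfun var p ->
  exists2 t : GRing.term R, GRing.rterm t &
    forall e : seq R, GRing.eval e t = p (nth 0 e).
Proof.
elim => [i|c|p1 p2 _ [t1 r1 h1] _ [t2 r2 h2]|p1 p2 _ [t1 r1 h1] _ [t2 r2 h2]].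
- by exists (GRing.Var R i).
- by exists (GRing.Const c).
- by exists (GRing.Add t1 t2) => /= [|e]; rewrite ?r1// h1 h2.
- by exists (GRing.Mul t1 t2) => /= [|e]; rewrite ?r1// h1 h2.
Qed.

Lemma semialg_formula P : semialg P ->
  exists2 F : ordered_qelim.ord.formula R, ordered_qelim.ord.rformula F &
    forall e : seq R, ordered_qelim.ord.holds e F <-> P (nth 0 e).
Proof.
elim => [p /polyfun_term[t rt h]|P1 _ [F rF h]|
         P1 P2 _ [F1 r1 h1] _ [F2 r2 h2]].
- by exists (ordered_qelim.ord.Lt (GRing.NatConst _ 0) t) => //= e; rewrite h.
- by exists (ordered_qelim.ord.Not F) => //= e; rewrite h.
- exists (ordered_qelim.ord.And F1 F2) => /= [|e]; first by rewrite r1.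
  by rewrite h1 h2.
Qed.

Lemma polyfun_eval (t : GRing.term R) (s : (nat -> R) -> seq R) :
  (forall i, polyfun var (fun x => (s x)`_i)) -> GRing.rterm t ->
  polyfun var (fun x => GRing.eval (s x) t).
Proof.
move=> ps; elim: t => //= [r _|k _|t1 h1 t2 h2 /andP[r1 r2]|t h r|t h k r|
    t1 h1 t2 h2 /andP[r1 r2]|t h k r].
- exact: polyfun_const.
- exact: polyfun_const.
- by apply: polyfunD; [exact: h1|exact: h2].
- by apply: polyfunN; exact: h.
- under eq_fun do rewrite -mulr_natr.
  by apply: polyfunM; [exact: h|exact: polyfun_const].
- by apply: polyfunM; [exact: h1|exact: h2].
- by apply: polyfunX; exact: h.
Qed.

Lemma semialg_qf_eval (F : ordered_qelim.ord.formula R)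
    (s : (nat -> R) -> seq R) :
  (forall i, polyfun var (fun x => (s x)`_i)) ->
  ordered_qelim.ord.qf_form F -> ordered_qelim.ord.rformula F ->
  semialg (fun x => ordered_qelim.ord.qf_eval (s x) F).
Proof.
move=> ps; elim: F => //= [b _ _|t1 t2 _ /andP[r1 r2]|t1 t2 _ /andP[r1 r2]|
  t1 t2 _ /andP[r1 r2]|F1 h1 F2 h2 /andP[q1 q2] /andP[r1 r2]|
  F1 h1 F2 h2 /andP[q1 q2] /andP[r1 r2]|
  F1 h1 F2 h2 /andP[q1 q2] /andP[r1 r2]|F h q r].
- exact: semialg_const.
- apply: (@semialg_ext (fun x => GRing.eval (s x) t1 = GRing.eval (s x) t2)).
    by move=> x; split => /eqP.
  by apply: semialg_eq; exact: polyfun_eval.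
- by apply: semialg_lt; exact: polyfun_eval.
- by apply: semialg_le; exact: polyfun_eval.
- apply: (semialg_ext _ (semialg_and (h1 q1 r1) (h2 q2 r2))) => x.
  by split=> /andP.
- apply: (semialg_ext _ (semialg_or (h1 q1 r1) (h2 q2 r2))) => x.
  by split=> /orP.
- apply: (semialg_ext _ (semialg_imp (h1 q1 r1) (h2 q2 r2))) => x.
  by split=> /implyP.
- apply: (semialg_ext _ (semialg_not (h q r))) => x.
  by split=> /negP.
Qed.

(* Tarski-Seidenberg; the bound variable is number 0 and the free ones are
   shifted, so that nested quantifiers can be treated by repeated
   application. *)
Lemma semialg_exists (P : (nat -> R) -> R -> Prop) :
  semialg (fun x => P (fun i => x i.+1) (x 0%N)) ->
  semialg (fun x => exists y, P x y).
Proof.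
move=> sP; have [N hN] := semialg_finsupp sP.
have [F rF hF] := semialg_formula sP.
have rE : ordered_qelim.ord.rformula (ordered_qelim.ord.Exists 0 F) by [].
have /andP[qG rG] := ordered_qelim.ord.quantifier_elim_wf
  (@qe_rcf.wf_QE_wproj R) rE.
set G := ordered_qelim.ord.quantifier_elim _ _ in qG rG.
pose s (x : nat -> R) := 0 :: mkseq x N.
apply: (@semialg_ext (fun x => ordered_qelim.ord.qf_eval (s x) G)); last first.
  apply: semialg_qf_eval => // -[|i] /=; first exact: polyfun_const.
  have [iN|Ni] := ltnP i N.
    by under eq_fun do rewrite nth_mkseq//; exact: (polyfun_coord var).
  under eq_fun do rewrite nth_default ?size_mkseq//.
  exact: polyfun_const.
move=> x.
have key y : P x y <-> ordered_qelim.ord.holds (set_nth 0 (s x) 0 y) F.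
  rewrite hF; pose e i := if i is j.+1 then x j else y.
  rewrite -(hN e)//= => -[|i]//= iN.
  by rewrite nth_mkseq// ltnW.
have /(_ (s x) _ rE) QE := ordered_qelim.ord.quantifier_elim_rformP
  (@qe_rcf.wf_QE_wproj R) (@qe_rcf.valid_QE_wproj R).
split => [/QE/=[y hy]|[y Pxy]]; first by exists y; exact/key.
by apply/QE => /=; exists y; exact/key.
Qed.

Lemma semialg_forall (P : (nat -> R) -> R -> Prop) :
  semialg (fun x => P (fun i => x i.+1) (x 0%N)) ->
  semialg (fun x => forall y, P x y).
Proof.
move=> sP; apply: (@semialg_ext (fun x => ~ exists y, ~ P x y)).
  move=> x; split => [h y|h [y]]; last exact.
  by apply: contrapT => nP; apply: h; exists y.
by apply/semialg_not/semialg_exists/semialg_not.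
Qed.

End Semialgebraic.

(** * Germs at 0 from the right, and two local-to-global principles on intervals *)

Section Germs.
Variable R : realType.

Definition near_pos (P : R -> Prop) :=
  exists2 d : R, 0 < d & forall u, 0 < u < d -> P u.

Lemma near_pos_and P Q : near_pos P -> near_pos Q ->
  near_pos (fun u => P u /\ Q u).
Proof.
move=> [d d0 hP] [e e0 hQ]; exists (Num.min d e); first by rewrite lt_min d0.
by move=> u; rewrite lt_min => /and3P[u0 ud ue]; split; [apply: hP|apply: hQ];
  rewrite u0.
Qed.

Lemma near_pos_imp (P Q : R -> Prop) :
  (forall u, 0 < u -> P u -> Q u) -> near_pos P -> near_pos Q.
Proof.
move=> PQ [d d0 hP]; exists d => // u /[dup] /andP[u0 _] ud.
by apply: PQ => //; exact: hP.
Qed.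

(** After a power of ['X] is factored out, the cofactor does not vanish at 0 and keeps its sign
    nearby, while the power is positive to the right of 0. *)
Lemma near_pos_poly (p : {poly R}) :
  near_pos (fun u => 0 < p.[u]) \/ near_pos (fun u => ~ 0 < p.[u]).
Proof.
have [->|p0] := eqVneq p 0.
  by right; exists 1 => // u _; rewrite horner0 ltxx.
have [m [q]] := multiplicity_XsubC p 0; rewrite p0/= => q0 ->.
have cq : (horner q) x @[x --> 0] --> q.[0] by exact: continuous_horner.
have E u : (q * ('X - 0%:P) ^+ m).[u] = q.[u] * u ^+ m.
  by rewrite hornerM horner_exp !hornerE subr0.
have := q0; rewrite rootE neq_lt => /orP[qn|qp]; [right|left].
- have [d /= d0 hd] := (nbhs_ballP _ _).1 (cvgr_lt _ cq _ qn).
  exists d => // u /andP[u0 ud]; rewrite E; apply/negP; rewrite -leNgt.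
  rewrite mulr_le0_ge0 ?exprn_ge0 ?(ltW u0)// ltW//; apply: hd.
  by rewrite /ball/= sub0r normrN gtr0_norm.
- have [d /= d0 hd] := (nbhs_ballP _ _).1 (cvgr_gt _ cq _ qp).
  exists d => // u /andP[u0 ud]; rewrite E.
  rewrite mulr_gt0 ?exprn_gt0//; apply: hd.
  by rewrite /ball/= sub0r normrN gtr0_norm.
Qed.

Lemma polyfun_horner (q : nat -> {poly R}) p : polyfun (@var R) p ->
  exists r : {poly R}, forall u, p (fun i => (q i).[u]) = r.[u].
Proof.
elim => [i|c|p1 p2 _ [r1 h1] _ [r2 h2]|p1 p2 _ [r1 h1] _ [r2 h2]].
- by exists (q i).
- by exists c%:P => u; rewrite hornerC.
- by exists (r1 + r2) => u; rewrite hornerD h1 h2.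
- by exists (r1 * r2) => u; rewrite hornerM h1 h2.
Qed.

(** Along a polynomial curve each atom becomes a polynomial in one variable, whose sign is
    eventually constant; Boolean combinations inherit this. *)
Lemma semialg_germ (q : nat -> {poly R}) P : semialg P ->
  near_pos (fun u => P (fun i => (q i).[u])) \/
  near_pos (fun u => ~ P (fun i => (q i).[u])).
Proof.
elim => [p /(polyfun_horner q)[r hr]|P1 _ h|P1 P2 _ h1 _ h2].
- by under eq_fun do rewrite hr; under [in X in _ \/ X]eq_fun do rewrite hr;
    exact: near_pos_poly.
- case: h => h; [right|left] => //.
  by apply: near_pos_imp h => u _; rewrite notK.
- case: h1 => h1; last first.
    by right; apply: near_pos_imp h1 => u _ nP [].
  case: h2 => h2; last first.
    by right; apply: near_pos_imp h2 => u _ nP [].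
  by left; exact: near_pos_and.
Qed.

(** Two points s < t that share a radius exceeding t - s would give both [E s t] and its negation.
    So the points admitting a given radius are spaced by at least that radius, hence countable in
    number, and the interval would be a countable union of such sets. *)
Lemma local_conflict (E : R -> R -> Prop) (a b : R) : a < b ->
  (forall t : R, a < t < b -> exists2 d : R, 0 < d &
     (forall u : R, t < u < t + d -> E t u) /\
     (forall u : R, t - d < u < t -> ~ E u t)) -> False.
Proof.
move=> ab H.
pose A n := [set t : R | a < t < b /\
  ((forall u : R, t < u < t + n.+1%:R^-1 -> E t u) /\
   (forall u : R, t - n.+1%:R^-1 < u < t -> ~ E u t))].
have Ac n : countable (A n).
  (* Equal floors would put the two points at distance less than the common radius [n.+1%:R^-1]. *)
  have inj : {in A n &, injective (fun t : R => Num.floor (t * n.+1%:R))}.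
    suff W s t : s < t -> A n s -> A n t ->
        Num.floor (s * n.+1%:R) = Num.floor (t * n.+1%:R) -> False.
      move=> s t; rewrite !inE => As At eqf.
      by case: (ltgtP s t) => // /W; [case|move/(_ At As) => []].
    move=> st [_ [hs _]] [_ [_ ht]] eqf.
    have lt : t - s < n.+1%:R^-1.
      rewrite -div1r ltr_pdivlMr// mulrBl.
      have h1 := floor_le (s * n.+1%:R).
      have h2 := lt_succ_floor (t * n.+1%:R); rewrite -eqf in h2.
      rewrite intrD mulr1z in h2; lra.
    move: (n.+1%:R^-1) lt hs ht => e lt hs ht.
    apply: (ht s); first by rewrite st andbT; lra.
    by apply: hs; rewrite st; lra.
  apply/countable_injP; exists (fun t => pickle (Num.floor (t * n.+1%:R))).
  by move=> s t As At /(pcan_inj pickleK); exact: inj.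
have : countable `]a, b[%classic.
  apply: (@sub_countable _ _ _ (\bigcup_n A n)); last exact: bigcup_countable.
  apply: subset_card_le => t /=; rewrite in_itv/= => tab.
  have [d d0 [h1 h2]] := H t tab.
  have dn : (Num.truncn d^-1).+1%:R^-1 < d.
    by rewrite invf_plt ?posrE// truncnS_gt.
  exists (Num.truncn d^-1) => //; split=> //.
  move: (_.+1%:R^-1) dn => e de; split=> u /andP[u1 u2];
    [apply: h1|apply: h2]; apply/andP; split=> //; lra.
(* A countable interval has Lebesgue measure 0, against its length [b - a]. *)
move=> /countable_lebesgue_measure0; rewrite lebesgue_measure_itv/= lte_fin ab.
by rewrite -EFinB => -[] /eqP; rewrite subr_eq0 => /eqP e; rewrite e ltxx in ab.
Qed.

(** A supremum argument: let [w] be the supremum of the points up to which [E s] holds. The left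
    condition at [w] shows that it is reached, and the right condition would carry [E s] beyond [w]
    if [w < t]. *)
Lemma local_transitive (E : R -> R -> Prop) (a b : R) :
  (forall x y z, E x y -> E y z -> E x z) ->
  (forall t : R, a < t < b -> exists2 d : R, 0 < d &
     (forall u : R, t < u < t + d -> E t u) /\
     (forall u : R, t - d < u < t -> E u t)) ->
  forall s t, a < s -> s < t -> t < b -> E s t.
Proof.
move=> trE H s t as_ st tb.
pose S := [set x : R | s < x <= t /\ forall y, s < y <= x -> E s y].
have [d d0 [hd _]] : exists2 d : R, 0 < d &
     (forall u : R, s < u < s + d -> E s u) /\
     (forall u : R, s - d < u < s -> E u s) by apply: H; lra.
have S0 : S !=set0.
  exists (Num.min t (s + d / 2)); split.
    by rewrite lt_min st ge_min lexx/= ltrDl divr_gt0.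
  move=> y; rewrite le_min => /and3P[sy _ yd]; apply: hd.
  by rewrite sy/=; lra.
have uS : has_ubound S by exists t => x [/andP[]].
have hS : has_sup S by [].
set w := sup S.
have sw : s < w.
  have [x Sx] := S0; have [/andP[sx _] _] := Sx.
  by apply: (lt_le_trans sx); exact: ub_le_sup.
have wt : w <= t by apply: ge_sup => // x [/andP[]].
have [e e0 [hr hl]] : exists2 d : R, 0 < d &
     (forall u : R, w < u < w + d -> E w u) /\
     (forall u : R, w - d < u < w -> E u w) by apply: H; lra.
have [x Sx wx] := sup_adherent e0 hS; rewrite -/w in wx.
have xw : x <= w by exact: ub_le_sup.
have Esw : E s w.
  have [/andP[sx xt] hx] := Sx.
  have [xw'|] := ltP x w; last first.
    by move=> wx'; apply: hx; rewrite sw.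
  by apply: (trE _ x); [apply: hx; rewrite sx/=|apply: hl; rewrite wx].
have Sw : forall y, s < y <= w -> E s y.
  move=> y /andP[sy]; rewrite le_eqVlt => /predU1P[->//|yw].
  have [z [_ hz] yz] := sup_gt S0 yw.
  by apply: hz; rewrite sy ltW.
have := wt; rewrite le_eqVlt => /predU1P[<-//|wt'].
have : S (Num.min t (w + e / 2)).
  split.
    by rewrite lt_min st ge_min lexx/=; lra.
  move=> y; rewrite le_min => /and3P[sy yt ye].
  have [yw|wy] := leP y w; first by apply: Sw; rewrite sy.
  by apply: (trE _ w) => //; apply: hr; rewrite wy; lra.
move=> /(ub_le_sup uS); rewrite -/w leNgt lt_min wt'/=; lra.
Qed.
End Germs.

(** * Monotonicity of semialgebraic functions of one variable near 0 *)

Section SemialgebraicFunctions.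
Variable R : realType.

Definition semialg_fun (g : R -> R) :=
  semialg (fun x : nat -> R => x 1%N = g (x 0%N)).

(** As [g] is known only through its graph, substituting a value of it costs one existential
    quantifier. *)
Lemma semialg_subst g (a : (nat -> R) -> R) (P : (nat -> R) -> R -> Prop) :
  semialg_fun g -> polyfun (@var R) a ->
  semialg (fun x => P (fun i => x i.+1) (x 0%N)) ->
  semialg (fun x => P x (g (a x))).
Proof.
move=> sg pa sP.
apply: (@semialg_ext _ (fun x => exists y, y = g (a x) /\ P x y)).
  by move=> x; split=> [[y [->]]//|h]; exists (g (a x)).
apply: (@semialg_exists _ (fun x y => y = g (a x) /\ P x y)).
apply: semialg_and => //.
pose s (x : nat -> R) i := if i is 1 then x 0%N else a (fun i => x i.+1).
apply: (@semialg_comp _ (fun x : nat -> R => x 1%N = g (x 0%N)) s) => //.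
have ps : polyfun (@var R) (fun x => a (fun i => x i.+1)).
  by apply: polyfun_comp pa => i; exact: (polyfun_coord (@var R)).
by case=> [|[|i]] //; exact: (polyfun_coord (@var R)).
Qed.

Lemma semialg_fun_lt g a b : semialg_fun g ->
  polyfun (@var R) a -> polyfun (@var R) b ->
  semialg (fun x => g (a x) < g (b x)).
Proof.
move=> sg pa pb.
apply: (@semialg_subst g a (fun x y => y < g (b x))) => //.
pose b' (x : nat -> R) := b (fun i => x i.+1).
apply: (@semialg_subst g b' (fun x y => x 0%N < y)) => //.
  by apply: polyfun_comp pb => i; exact: (polyfun_coord (@var R)).
by apply: semialg_lt; exact: (polyfun_coord (@var R)).
Qed.

Lemma semialg_near_pos (P : R -> R -> Prop) :
  semialg (fun x => P (x 0%N) (x 1%N)) ->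
  semialg (fun x => near_pos (P (x 0%N))).
Proof.
move=> sP.
apply: (@semialg_ext _ (fun x => exists d, 0 < d /\
    forall u, 0 < u /\ u < d -> P (x 0%N) u)).
  move=> x; split=> [[d [d0 h]]|[d d0 h]]; exists d => //.
    by move=> u /andP uh; exact: h.
  by split=> // u /andP; exact: h.
apply: (@semialg_exists _ (fun x d => 0 < d /\
    forall u, 0 < u /\ u < d -> P (x 0%N) u)).
have pv i := polyfun_coord (@var R) i.
apply: semialg_and.
  by apply: semialg_lt; (exact: polyfun_const || exact: pv).
apply: (@semialg_forall _ (fun x u => 0 < u /\ u < x 0%N -> P (x 1%N) u)).
apply: semialg_imp.
  by apply: semialg_and; apply: semialg_lt; (exact: polyfun_const || exact: pv).
pose s (x : nat -> R) i := if i is 1 then x 0%N else x 2%N.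
apply: (@semialg_comp _ (fun x : nat -> R => P (x 0%N) (x 1%N)) s) => //.
by case=> [|[|i]]; exact: pv.
Qed.

Lemma semialg_near0 (P : R -> Prop) : semialg (fun x => P (x 0%N)) ->
  near_pos P \/ near_pos (fun t => ~ P t).
Proof.
move=> /(semialg_germ (fun=> 'X)).
by under eq_fun do rewrite hornerX; under [X in _ \/ near_pos X]eq_fun do
  rewrite hornerX.
Qed.

(** Compares [t] with its neighbour at distance [u], on the left when [l] is true; the smaller point
    always comes first in [E]. *)
Let side (l : bool) (E : R -> R -> Prop) (t u : R) :=
  if l then E (t - u) t else E t (t + u).

(** The germ dichotomy is used twice: in [u] for each fixed [t], and then in [t], which requires
    eliminating the quantifiers hidden in [near_pos]. *)
Lemma semialg_side_germ l (E : R -> R -> Prop) :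
  semialg (fun x => E (x 0%N) (x 1%N)) ->
  near_pos (fun t => near_pos (side l E t)) \/
  near_pos (fun t => near_pos (side l (fun s t => ~ E s t) t)).
Proof.
move=> sE.
have pv i := polyfun_coord (@var R) i.
have sS : semialg (fun x => side l E (x 0%N) (x 1%N)).
  pose s (x : nat -> R) i := if l
    then (if i is 0 then x 0%N - x 1%N else x 0%N)
    else (if i is 0 then x 0%N else x 0%N + x 1%N).
  apply: semialg_ext (@semialg_comp _ (fun x => E (x 0%N) (x 1%N)) s _ sE).
    by move=> x; rewrite /s /side; case: (l).
  by rewrite /s; case: (l) => -[|i]//; (exact: pv ||
    exact: (polyfunB (pv _) (pv _)) ||
    exact: (polyfunD (pv _) (pv _))).
have [|h] := @semialg_near0 (fun t => near_pos (side l E t))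
  (semialg_near_pos sS); [by left|right].
apply: near_pos_imp h => t _ nS.
(* The curve that freezes the first variable at [t] and lets the second one run to 0. *)
pose q i : {poly R} := if i is 0 then t%:P else 'X.
have := semialg_germ q sS; rewrite /q.
under eq_fun do rewrite hornerC hornerX.
under [X in _ \/ near_pos X]eq_fun do rewrite hornerC hornerX.
by case=> //; rewrite /side; case: (l).
Qed.

(** For small [t], the comparison of [g t] with its right neighbours has one answer for all [t], and
    so has that with its left neighbours. If the answers agree, the relation is transitive and
    becomes global; if they disagree, [local_conflict] applies to [E] or to its negation. *)
Lemma semialg_fun_monotone g : semialg_fun g ->
  exists2 d, 0 < d &
    (forall s t, 0 < s -> s < t -> t < d -> g s <= g t) \/
    (forall s t, 0 < s -> s < t -> t < d -> g t <= g s).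
Proof.
move=> sg; pose E s t := g t < g s.
have pv i := polyfun_coord (@var R) i.
have sE : semialg (fun x => E (x 0%N) (x 1%N)) 
    by exact: (semialg_fun_lt sg (pv 1%N) (pv 0%N)).
have both P Q : near_pos (fun t => near_pos (side false P t)) ->
    near_pos (fun t => near_pos (side true Q t)) ->
    exists2 d : R, 0 < d & forall t, 0 < t < d -> exists2 e : R, 0 < e &
      (forall u : R, t < u < t + e -> P t u) /\
      (forall u : R, t - e < u < t -> Q u t).
  move=> hP hQ; have [d d0 h] := near_pos_and hP hQ; exists d => // t td.
  have [h1 h2] := h t td; have [e e0 {}h] := near_pos_and h1 h2.
  exists e => //; split=> u /andP[u1 u2].
    have [|+ _] := h (u - t); first by apply/andP; split; lra.
    by rewrite /side addrC subrK.
  have [|_ +] := h (t - u); first by apply/andP; split; lra.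
  by rewrite /side opprB addrC subrK.
have [hr|hr] := @semialg_side_germ false E sE;
  have [hl|hl] := @semialg_side_germ true E sE;
  have [d d0 h] := both _ _ hr hl; exists d => //.
- right=> s t s0 st td; apply: ltW.
  by apply: (@local_transitive _ E 0 d) => // x y z yx zy; exact: lt_trans yx.
- by exfalso; exact: (@local_conflict _ E 0 d).
- exfalso; apply: (@local_conflict _ (fun s t => ~ E s t) 0 d) => // t td.
  have [e e0 [h1 h2]] := h t td; exists e => //; split => // u uh.
  by rewrite notK; exact: h2.
- left=> s t s0 st td; rewrite leNgt; apply/negP.
  apply: (@local_transitive _ (fun s t => ~ E s t) 0 d) => // x y z.
  by rewrite /E => /negP + /negP; rewrite -!leNgt => xy yz; apply/negP;
    rewrite -leNgt (le_trans xy).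
Qed.

End SemialgebraicFunctions.

(** * Polynomial functions of a matrix, and their Taylor formula *)

Section MatrixPolynomials.
Variables (R : realType) (n : nat).
Implicit Types (Q H M : 'M[R]_n) (F : 'M[R]_n -> R).

Definition entry (ij : 'I_n * 'I_n) M : R := M ij.1 ij.2.

Definition mxpolyfun p q (A : 'M[R]_n -> 'M[R]_(p, q)) :=
  forall i j, polyfun entry (fun M => A M i j).

Lemma mxpolyfun_id : mxpolyfun id.
Proof. by move=> i j; exact: (polyfun_coord entry (i, j)). Qed.

Lemma mxpolyfun_const p q (B : 'M[R]_(p, q)) : mxpolyfun (fun=> B).
Proof. by move=> i j; exact: polyfun_const. Qed.

Lemma mxpolyfunM p q r (A : 'M[R]_n -> 'M[R]_(p, q))
    (B : 'M[R]_n -> 'M[R]_(q, r)) :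
  mxpolyfun A -> mxpolyfun B -> mxpolyfun (fun M => A M *m B M).
Proof.
move=> pA pB i j; under eq_fun do rewrite mxE.
by apply: polyfun_sum => k _; exact: polyfunM.
Qed.

Lemma mxpolyfun_tr p q (A : 'M[R]_n -> 'M[R]_(p, q)) :
  mxpolyfun A -> mxpolyfun (fun M => (A M)^T).
Proof. by move=> pA i j; under eq_fun do rewrite mxE; exact: pA. Qed.

Lemma mxpolyfunD p q (A B : 'M[R]_n -> 'M[R]_(p, q)) :
  mxpolyfun A -> mxpolyfun B -> mxpolyfun (fun M => A M + B M).
Proof.
by move=> pA pB i j; under eq_fun do rewrite mxE; exact: polyfunD.
Qed.

Lemma mxpolyfunZ p q a (A : 'M[R]_n -> 'M[R]_(p, q)) :
  mxpolyfun A -> mxpolyfun (fun M => a *: A M).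
Proof.
move=> pA i j; under eq_fun do rewrite mxE.
by apply: polyfunM => //; exact: polyfun_const.
Qed.

Lemma mxpolyfunB p q (A B : 'M[R]_n -> 'M[R]_(p, q)) :
  mxpolyfun A -> mxpolyfun B -> mxpolyfun (fun M => A M - B M).
Proof.
move=> pA pB; under eq_fun do rewrite -[- _]scaleN1r.
by apply: mxpolyfunD => //; exact: mxpolyfunZ.
Qed.

Lemma polyfun_frob_dot p q (A B : 'M[R]_n -> 'M[R]_(p, q)) :
  mxpolyfun A -> mxpolyfun B -> polyfun entry (fun M => frob_dot (A M) (B M)).
Proof.
by move=> pA pB; do 2![apply: polyfun_sum => ? _]; exact: polyfunM.
Qed.

Lemma frob_dotDl p q (A B C : 'M[R]_(p, q)) :
  frob_dot (A + B) C = frob_dot A C + frob_dot B C.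
Proof.
rewrite /frob_dot -big_split/=; apply: eq_bigr => i _.
by rewrite -big_split/=; apply: eq_bigr => j _; rewrite mxE mulrDl.
Qed.

Lemma frob_dotZl p q a (A B : 'M[R]_(p, q)) :
  frob_dot (a *: A) B = a * frob_dot A B.
Proof.
rewrite /frob_dot mulr_sumr; apply: eq_bigr => i _.
by rewrite mulr_sumr; apply: eq_bigr => j _; rewrite mxE mulrA.
Qed.

Lemma frob_dot_mxtrace p q (A B : 'M[R]_(p, q)) :
  frob_dot A B = \tr (A^T *m B).
Proof.
rewrite /frob_dot exchange_big; apply: eq_bigr => j _.
by rewrite mxE; apply: eq_bigr => i _; rewrite mxE.
Qed.

Lemma frob_dotC p q (A B : 'M[R]_(p, q)) : frob_dot A B = frob_dot B A.
Proof. by do 2![apply: eq_bigr => ? _]; rewrite mulrC. Qed.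

Lemma frob_dotDr p q (A B C : 'M[R]_(p, q)) :
  frob_dot A (B + C) = frob_dot A B + frob_dot A C.
Proof. by rewrite !(frob_dotC A) frob_dotDl. Qed.

Lemma frob_dotZr p q a (A B : 'M[R]_(p, q)) :
  frob_dot A (a *: B) = a * frob_dot A B.
Proof. by rewrite !(frob_dotC A) frob_dotZl. Qed.

Lemma frob_dot_delta_mx M i j : frob_dot M (delta_mx i j) = M i j.
Proof.
rewrite /frob_dot (bigD1 i)//= (bigD1 j)//= !mxE !eqxx mulr1.
rewrite !big1 ?addr0//.
  move=> k ki; rewrite big1// => l _; rewrite mxE (negPf ki) mulr0//.
by move=> l lj; rewrite mxE (negPf lj) andbF mulr0.
Qed.

Lemma frob_dot_ge0 p q (A : 'M[R]_(p, q)) : 0 <= frob_dot A A.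
Proof. by do 2![apply: sumr_ge0 => ? _]; rewrite -expr2 sqr_ge0. Qed.

Lemma sqr_frob_norm p q (A : 'M[R]_(p, q)) : frob_norm A ^+ 2 = frob_dot A A.
Proof. by rewrite sqr_sqrtr// frob_dot_ge0. Qed.

Lemma frob_dot_eq0 p q (A : 'M[R]_(p, q)) : frob_dot A A = 0 -> A = 0.
Proof.
move=> A0; apply/matrixP => i j; rewrite mxE.
have h0 k l : 0 <= A k l * A k l by rewrite -expr2 sqr_ge0.
move/eqP: A0; rewrite psumr_eq0; last by move=> k _; exact: sumr_ge0.
move=> /allP/(_ i (mem_index_enum _))/= /eqP/eqP.
rewrite psumr_eq0// => /allP/(_ j (mem_index_enum _))/=.
by rewrite mulf_eq0 orbb => /eqP.
Qed.

Lemma ler_entry_norm p q (A : 'M[R]_(p, q)) i j : `|A i j| <= `|A|.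
Proof.
by rewrite [leRHS]/Num.Def.normr/= mx_normrE; apply/bigmax_geP; right;
  exists (i, j).
Qed.

Lemma mx_norm_le p q (A : 'M[R]_(p, q)) e : 0 <= e ->
  (forall i j, `|A i j| <= e) -> `|A| <= e.
Proof.
move=> e0 h; rewrite [leLHS]/Num.Def.normr/= mx_normrE.
by apply/bigmax_leP; split=> // -[i j] _; exact: h.
Qed.

Lemma polyfun_continuous F : polyfun entry F -> continuous F.
Proof.
elim => [[i j]|c|p q _ h1 _ h2|p q _ h1 _ h2] M.
- exact: coord_continuous.
- exact: cst_continuous.
- exact: (continuousD (h1 M) (h2 M)).
- exact: (continuousM (h1 M) (h2 M)).
Qed.

Lemma polyfun_bounded F b : polyfun entry F ->
  exists2 C, 0 <= C & forall Q, `|Q| <= b -> `|F Q| <= C.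
Proof.
elim => [[i j]|c|p q _ [C1 ? h1] _ [C2 ? h2]|p q _ [C1 ? h1] _ [C2 ? h2]].
- exists `|b| => // Q Qb; rewrite /entry/=.
  by rewrite (le_trans (ler_entry_norm _ _ _))// (le_trans Qb)// ler_norm.
- by exists `|c|.
- exists (C1 + C2) => [|Q Qb]; first exact: addr_ge0.
  by rewrite (le_trans (ler_normD _ _))// lerD ?h1 ?h2.
- exists (C1 * C2) => [|Q Qb]; first exact: mulr_ge0.
  by rewrite normrM ler_pM// ?h1 ?h2.
Qed.

Lemma ler_norm_frob_dot p q (A B : 'M[R]_(p, q)) :
  `|frob_dot A B| <= (\sum_i \sum_j `|A i j|) * `|B|.
Proof.
rewrite mulr_suml (le_trans (ler_norm_sum _ _ _))// ler_sum// => i _.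
rewrite mulr_suml (le_trans (ler_norm_sum _ _ _))// ler_sum// => j _.
by rewrite normrM ler_wpM2l// ler_entry_norm.
Qed.

Lemma frob_dot_bounded (G : 'M[R]_n -> 'M[R]_n) b : mxpolyfun G ->
  exists2 C, 0 <= C & forall Q H, `|Q| <= b -> `|frob_dot (G Q) H| <= C * `|H|.
Proof.
move=> pG.
have /choice[C hC] ij : exists C, 0 <= C /\ forall Q, `|Q| <= b ->
    `|G Q ij.1 ij.2| <= C.
  by have [C C0 h] := polyfun_bounded b (pG ij.1 ij.2); exists C.
exists (\sum_i \sum_j C (i, j)).
  by apply: sumr_ge0 => i _; apply: sumr_ge0 => j _; have [] := hC (i, j).
move=> Q H Qb; rewrite (le_trans (ler_norm_frob_dot _ _))// ler_wpM2r//.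
apply: ler_sum => i _; apply: ler_sum => j _.
by have [_] := hC (i, j); exact.
Qed.

(** Induction on the construction of [F] yields at once a polynomial gradient and a quadratic
    remainder uniform on bounded sets; [derive_delta_mx] then identifies the gradient with
    [egrad]. *)
Lemma polyfun_taylor F : polyfun entry F ->
  exists2 G : 'M[R]_n -> 'M[R]_n, mxpolyfun G &
    forall b, exists2 C, 0 <= C & forall Q Q', `|Q| <= b -> `|Q'| <= b ->
      `|F Q' - F Q - frob_dot (G Q) (Q' - Q)| <= C * `|Q' - Q| ^+ 2.
Proof.
elim => [[i j]|c|p q pp [G1 pG1 h1] pq [G2 pG2 h2]|
         p q pp [G1 pG1 h1] pq [G2 pG2 h2]].
- exists (fun=> delta_mx i j); first exact: mxpolyfun_const.
  move=> b; exists 0 => // Q Q' _ _.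
  by rewrite frob_dotC frob_dot_delta_mx !mxE subrr normr0 mul0r.
- exists (fun=> 0); first exact: mxpolyfun_const.
  move=> b; exists 0 => // Q Q' _ _.
  by rewrite -(scale0r 0) frob_dotZl mul0r !subrr normr0 mul0r.
- exists (fun Q => G1 Q + G2 Q); first exact: mxpolyfunD.
  move=> b; have [C1 C10 {}h1] := h1 b; have [C2 C20 {}h2] := h2 b.
  exists (C1 + C2) => [|Q Q' Qb Q'b]; first exact: addr_ge0.
  rewrite frob_dotDl mulrDl.
  have -> : p Q' + q Q' - (p Q + q Q) -
      (frob_dot (G1 Q) (Q' - Q) + frob_dot (G2 Q) (Q' - Q)) =
    (p Q' - p Q - frob_dot (G1 Q) (Q' - Q)) +
    (q Q' - q Q - frob_dot (G2 Q) (Q' - Q)) by ring.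
  by rewrite (le_trans (ler_normD _ _))// lerD ?h1 ?h2.
- exists (fun Q => p Q *: G2 Q + q Q *: G1 Q).
    by move=> i j; under eq_fun do rewrite !mxE;
      apply: polyfunD; apply: polyfunM.
  move=> b; have [C1 C10 {}h1] := h1 b; have [C2 C20 {}h2] := h2 b.
  have [K1 K10 hK1] := frob_dot_bounded b pG1.
  have [K2 K20 hK2] := frob_dot_bounded b pG2.
  have [Bp Bp0 hBp] := polyfun_bounded b pp.
  have [Bq Bq0 hBq] := polyfun_bounded b pq.
  (* The three summands bound the three terms into which the remainder of a product is split below:
     remainder of [p] times [q], [p] times remainder of [q], and linear part of [p] times increment
     of [q]. The absolute value on [b] keeps the constant nonnegative for every [b]. *)
  exists (C1 * Bq + Bp * C2 + K1 * (K2 + C2 * (`|b| + `|b|))) => [|Q Q' Qb Q'b].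
    by rewrite ?(addr_ge0, mulr_ge0).
  rewrite frob_dotDl !frob_dotZl.
  have -> : p Q' * q Q' - p Q * q Q -
      (p Q * frob_dot (G2 Q) (Q' - Q) + q Q * frob_dot (G1 Q) (Q' - Q)) =
    (p Q' - p Q - frob_dot (G1 Q) (Q' - Q)) * q Q' +
    p Q * (q Q' - q Q - frob_dot (G2 Q) (Q' - Q)) +
    frob_dot (G1 Q) (Q' - Q) * (q Q' - q Q) by ring.
  have d0 : `|Q' - Q| <= `|b| + `|b|.
    by rewrite (le_trans (ler_normB _ _))// lerD// ?(le_trans Q'b, le_trans Qb)
      ?ler_norm.
  have hq : `|q Q' - q Q| <= (K2 + C2 * (`|b| + `|b|)) * `|Q' - Q|.
    have -> : q Q' - q Q = frob_dot (G2 Q) (Q' - Q) +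
      (q Q' - q Q - frob_dot (G2 Q) (Q' - Q)) by ring.
    rewrite mulrDl (le_trans (ler_normD _ _))// lerD ?hK2//.
    rewrite (le_trans (h2 _ _ Qb Q'b))// -mulrA ler_wpM2l// expr2.
    by rewrite ler_wpM2r.
  rewrite 2![in leRHS]mulrDl; apply: le_trans (ler_normD _ _) _; apply: lerD.
    apply: le_trans (ler_normD _ _) _; apply: lerD; rewrite normrM.
      by rewrite -mulrA [Bq * _]mulrC mulrA ler_pM// ?h1 ?hBq.
    by rewrite -mulrA ler_pM// ?h2 ?hBp.
  by rewrite normrM expr2 mulrACA ler_pM// ?hK1.
Qed.

Lemma derive_delta_mx F M C Q i j :
  (forall Q', `|Q'| <= `|Q| + 1 ->
    `|F Q' - F Q - frob_dot M (Q' - Q)| <= C * `|Q' - Q| ^+ 2) ->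
  'D_(delta_mx i j) F Q = M i j.
Proof.
move=> hF.
have d1 : `|delta_mx i j : 'M[R]_n| <= 1.
  apply: mx_norm_le => // k l; rewrite mxE.
  by case: (_ && _); rewrite ?normr1 ?normr0.
(* The sign of [C] is read off the hypothesis at the single point [Q + delta_mx i j]. *)
have C0 : 0 <= C.
  move: (hF (Q + delta_mx i j)); rewrite (addrC Q) addrK => /(_ _).
  have d0 : 0 < `|delta_mx i j : 'M[R]_n| ^+ 2.
    rewrite exprn_gt0// normr_gt0; apply/eqP => /matrixP/(_ i j)/eqP.
    by rewrite !mxE !eqxx oner_eq0.
  rewrite addrC (le_trans (ler_normD _ _)) ?lerD2l// => /(_ isT) h.
  by rewrite -(pmulr_lge0 _ d0) (le_trans _ h).
apply: cvg_lim => //; apply/cvgrPdist_le => /= e e0.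
exists (Num.min 1 (e / (C + 1))) => /=.
  by rewrite lt_min ltr01 divr_gt0// ltr_wpDl.
move=> h; rewrite /= sub0r normrN lt_min => /andP[h1 he] h0.
have hd : `|h *: delta_mx i j : 'M[R]_n| <= `|h|.
  by rewrite normrZ ler_piMr.
have := hF (h *: delta_mx i j + Q).
rewrite addrK frob_dotZr frob_dot_delta_mx => /(_ _).
rewrite (le_trans (ler_normD _ _))//; last first.
  by rewrite addrC lerD2l (le_trans hd)// ltW.
move=> /(_ isT) hF'.
have -> : M i j - h^-1 *: (F (h *: delta_mx i j + Q) - F Q) =
    - h^-1 * (F (h *: delta_mx i j + Q) - F Q - h * M i j).
  by rewrite /GRing.scale/=; field.
rewrite normrM normrN normfV ler_pdivrMl ?normr_gt0//.
rewrite (le_trans hF')// (@le_trans _ _ (C * `|h| ^+ 2))//.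
  by rewrite ler_wpM2l// lerXn2r// ?nnegrE.
rewrite expr2 mulrCA ler_wpM2l// (le_trans _ (ltW (_ : `|h| * (C + 1) < e)))//.
  by rewrite mulrC ler_wpM2l// lerDl.
by rewrite -ltr_pdivlMr// ltr_wpDl.
Qed.

Lemma polyfun_egrad F : polyfun entry F ->
  mxpolyfun (egrad F) /\ forall b, exists2 C, 0 <= C & forall Q Q',
    `|Q| <= b -> `|Q'| <= b ->
    `|F Q' - F Q - frob_dot (egrad F Q) (Q' - Q)| <= C * `|Q' - Q| ^+ 2.
Proof.
move=> /polyfun_taylor[G pG hG].
suff -> : egrad F = G by [].
apply/funext => Q; apply/matrixP => i j; rewrite mxE.
have [C _ hC] := hG (`|Q| + 1).
by apply: (@derive_delta_mx _ _ C) => Q' Q'b; apply: hC => //; rewrite lerDl.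
Qed.

End MatrixPolynomials.

(** * The orthogonal group: compactness, and Taylor's formula with the projected gradient *)

Section OrthogonalGroup.
Variables (R : realType) (n : nat).
Implicit Types (Q H M : 'M[R]_n) (F : 'M[R]_n -> R).

Lemma On_mulmxT Q : On Q -> Q *m Q^T = 1%:M.
Proof. exact: mulmx1C. Qed.

Lemma On_mulmx Q M : On Q -> On M -> On (Q *m M).
Proof.
move=> oQ oM; rewrite /On/= trmx_mul mulmxA -(mulmxA M^T).
by rewrite (_ : Q^T *m Q = 1%:M)// mulmx1.
Qed.

Lemma On_norm_le1 Q : On Q -> `|Q| <= 1.
Proof.
move=> oQ; apply: mx_norm_le => // i j.
rewrite -(@ler_pXn2r _ 2) ?nnegrE// expr1n real_normK ?num_real//.
have /matrixP/(_ j j) := oQ; rewrite !mxE eqxx mulr1n => <-.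
rewrite (bigD1 i)//= mxE expr2 lerDl; apply: sumr_ge0 => k _.
by rewrite mxE -expr2 sqr_ge0.
Qed.

Lemma mulmx_norm_le p q r (A : 'M[R]_(p, q)) (B : 'M[R]_(q, r)) :
  `|A *m B| <= q%:R * (`|A| * `|B|).
Proof.
apply: mx_norm_le => [|i j]; first by rewrite ?mulr_ge0.
rewrite mxE (le_trans (ler_norm_sum _ _ _))//.
rewrite (@le_trans _ _ (\sum_(k < q) `|A| * `|B|))//.
  by apply: ler_sum => k _; rewrite normrM ler_pM// ler_entry_norm.
by rewrite sumr_const card_ord -[leLHS]mulr_natl.
Qed.

Lemma trmx_norm_le p q (A : 'M[R]_(p, q)) : `|A^T| <= `|A|.
Proof. by apply: mx_norm_le => // i j; rewrite mxE ler_entry_norm. Qed.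

Lemma On_closed : closed (@On R n).
Proof.
rewrite (_ : @On R n = \bigcap_(ij : 'I_n * 'I_n)
  [set Q | (Q^T *m Q) ij.1 ij.2 = (1%:M : 'M[R]_n) ij.1 ij.2]).
  apply: closed_bigI => -[i j] _ /=.
  apply: (@closed_comp _ _ (fun Q : 'M[R]_n => (Q^T *m Q) i j)
    [set x | x = (1%:M : 'M[R]_n) i j]); last exact: closed_eq.
  move=> Q _; apply: polyfun_continuous.
  by apply: mxpolyfunM; first apply: mxpolyfun_tr; exact: mxpolyfun_id.
apply/seteqP; split => Q /=; first by move=> oQ [i j] _ /=; rewrite oQ.
by move=> h; apply/matrixP => i j; exact: (h (i, j)).
Qed.

(** Closed bounded sets of row vectors are compact; the result is carried to matrices by the
    continuous map [vec_mx]. *)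
Lemma On_compact : compact (@On R n).
Proof.
pose V := [set v : 'rV[R]_(n * n) | On (vec_mx v)].
have vc : continuous (fun v : 'rV[R]_(n * n) => vec_mx v : 'M[R]_n).
  move=> v; apply/(@cvgrPdist_le _ _ _ (nbhs v)) => e e0.
  apply/(nbhs_ballP v); exists e => //= w; rewrite -ball_normE/= => vw.
  rewrite -linearB (le_trans _ (ltW vw))//.
  by apply: mx_norm_le => // i j; rewrite mxE ler_entry_norm.
have -> : @On R n = vec_mx @` V.
  apply/seteqP; split => [Q oQ|_ [v Vv <-]//].
  by exists (mxvec Q); rewrite /V/= mxvecK.
apply: continuous_compact; first by apply: continuous_subspaceT.
apply: bounded_closed_compact.
  exists 1; split=> // x x1 v Vv /=; apply: (le_trans _ (ltW x1)).
  apply: mx_norm_le => // i j; rewrite (ord1 i).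
  have [k l] := mxvec_indexP j.
  have := ler_entry_norm (vec_mx v) k l; rewrite mxE => /le_trans; apply.
  exact: On_norm_le1.
by apply: closed_comp On_closed => v _; exact: vc.
Qed.

Lemma polyfun_bounded_On F : polyfun (@entry R n) F ->
  exists2 C, 0 <= C & forall Q, On Q -> `|F Q| <= C.
Proof.
move=> /(polyfun_bounded 1)[C C0 h]; exists C => // Q oQ.
by apply: h; exact: On_norm_le1.
Qed.

Lemma mxpolyfun_Lambda F : polyfun (@entry R n) F -> mxpolyfun (Lambda F).
Proof.
move=> /polyfun_egrad[pG _]; apply: mxpolyfunZ.
by apply: mxpolyfunB; apply: mxpolyfunM => //;
  try exact: mxpolyfun_id; apply: mxpolyfun_tr => //; exact: mxpolyfun_id.
Qed.

Lemma mxpolyfun_proj_grad F :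
  polyfun (@entry R n) F -> mxpolyfun (proj_grad F).
Proof.
move=> pF; apply: mxpolyfunM; first exact: mxpolyfun_id.
exact: mxpolyfun_Lambda.
Qed.

(* On O_n the normal part of the gradient is [Q S] with [S] symmetric, and
   [Q^T H + H^T Q = - H^T H] for a chord [H], so that the normal part
   contributes to second order only. *)
Lemma On_taylor F : polyfun (@entry R n) F ->
  exists2 C, 0 <= C & forall Q Q', On Q -> On Q' ->
    `|F Q' - F Q - frob_dot (proj_grad F Q) (Q' - Q)| <= C * `|Q' - Q| ^+ 2.
Proof.
move=> pF; have [pG /(_ 1)[C1 C10 hC1]] := polyfun_egrad pF.
pose S Q : 'M[R]_n := 2^-1 *: (Q^T *m egrad F Q + (egrad F Q)^T *m Q).
have pS : mxpolyfun S.
  apply: mxpolyfunZ.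
  by apply: mxpolyfunD; apply: mxpolyfunM => //;
    try exact: mxpolyfun_id; apply: mxpolyfun_tr => //; exact: mxpolyfun_id.
have [C2 C20 hC2] := frob_dot_bounded 1 pS.
exists (C1 + C2 * n%:R) => [|Q Q' oQ oQ']; first by rewrite addr_ge0// mulr_ge0.
have Q1 := On_norm_le1 oQ; have Q'1 := On_norm_le1 oQ'.
set H := Q' - Q.
have ST : (S Q)^T = S Q.
  by rewrite /S linearZ/= linearD/= !trmx_mul !trmxK addrC.
have GP : egrad F Q = proj_grad F Q + Q *m S Q.
  rewrite /proj_grad /Lambda /S -mulmxDr -scalerDr addrACA addNr addr0.
  rewrite -mulr2n -[X in _ *: X]scaler_nat scalerA mulVf ?pnatr_eq0// scale1r.
  by rewrite mulmxA On_mulmxT// mul1mx.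
have HH : Q^T *m H + H^T *m Q = - (H^T *m H).
  apply/eqP; rewrite -addr_eq0; apply/eqP.
  have eQ : Q^T *m Q = 1%:M by [].
  have eQ' : Q'^T *m Q' = 1%:M by [].
  have -> : H^T = Q'^T - Q^T by rewrite /H linearB.
  rewrite /H !(mulmxBl, mulmxBr) eQ eQ'.
  set a := Q^T *m Q'; set b := Q'^T *m Q.
  by apply/matrixP => i j; rewrite !mxE; ring.
have QSH : frob_dot (Q *m S Q) H = - (2^-1 * frob_dot (S Q) (H^T *m H)).
  have e1 : frob_dot (Q *m S Q) H = frob_dot (S Q) (Q^T *m H).
    by rewrite !frob_dot_mxtrace trmx_mul mulmxA.
  have e2 : frob_dot (S Q) (Q^T *m H) = frob_dot (S Q) (H^T *m Q).
    rewrite !frob_dot_mxtrace ST -mxtrace_tr !trmx_mul trmxK ST mxtrace_mulC.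
    by rewrite mulmxA.
  have e3 : frob_dot (S Q) (Q^T *m H + H^T *m Q) = - frob_dot (S Q) (H^T *m H).
    by rewrite HH -scaleN1r frob_dotZr mulN1r.
  by rewrite e1; move: e3; rewrite frob_dotDr -e2; lra.
have := hC1 _ _ Q1 Q'1; rewrite -/H GP frob_dotDl QSH => h.
have h2 : `|2^-1 * frob_dot (S Q) (H^T *m H)| <= C2 * n%:R * `|H| ^+ 2.
  rewrite normrM (@le_trans _ _ `|frob_dot (S Q) (H^T *m H)|)//.
    by rewrite ler_piMl// ger0_norm; lra.
  rewrite (le_trans (hC2 _ _ Q1))// -mulrA ler_wpM2l//.
  rewrite (le_trans (mulmx_norm_le _ _))// ler_wpM2l// expr2 ler_wpM2r//.
  exact: trmx_norm_le.
rewrite mulrDl.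
set u := _ - _ in h *; rewrite (_ : _ - _ =
  (F Q' - F Q - (frob_dot (proj_grad F Q) H -
     2^-1 * frob_dot (S Q) (H^T *m H)))
  - 2^-1 * frob_dot (S Q) (H^T *m H)); last by ring.
by rewrite (le_trans (ler_normB _ _))// lerD.
Qed.

End OrthogonalGroup.

(** * Semialgebraic selection from families of compact sets of matrices *)

Section SemialgebraicSelection.
Variables (R : realType) (n : nat).
Implicit Types (Q : 'M[R]_n) (F : 'M[R]_n -> R) (D : R -> set 'M[R]_n).

Local Notation pv := (polyfun_coord (@var R)).

(** The bound variables occupy the first [k] places and the free ones are shifted by [k]. In the
    inductive step the newly bound variable is number [k]: last of the enlarged block, first of the
    former free ones. *)
Lemma semialg_exists_block k (S : (nat -> R) -> Prop) : semialg S ->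
  semialg (fun x => exists y : nat -> R,
    S (fun i => if (i < k)%N then y i else x (i - k)%N)).
Proof.
move=> sS; elim: k => [|k ih].
  apply: semialg_ext sS => x.
  have E (y : nat -> R) :
      (fun i => if (i < 0)%N then y i else x (i - 0)%N) = x.
    by apply/funext => i; rewrite subn0.
  by split => [Sx|[y]]; [exists x|]; rewrite E.
set T := fun x => _ in ih.
pose cons (x : nat -> R) (z : R) i := if i is j.+1 then x j else z.
apply: (@semialg_ext _ (fun x => exists z, T (cons x z))); last first.
  apply: semialg_exists; apply: semialg_ext ih => x.
  suff -> : cons (fun i => x i.+1) (x 0%N) = x by [].
  by apply/funext => -[].
move=> x; split => [[z [y h]]|[y h]].
- exists (fun i => if i == k then z else y i); move: h.
  suff -> : (fun i => if (i < k)%N then y i else cons x z (i - k)%N) =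
    (fun i => if (i < k.+1)%N then if i == k then z else y i
              else x (i - k.+1)%N)
    by [].
  apply/funext => i; rewrite ltnS; case: (ltngtP i k) => // [ki|->].
    by rewrite -(subnSK ki).
  by rewrite subnn.
- exists (y k), y; move: h.
  suff -> : (fun i => if (i < k)%N then y i else cons x (y k) (i - k)%N) =
    (fun i => if (i < k.+1)%N then y i else x (i - k.+1)%N) by [].
  apply/funext => i; rewrite ltnS; case: (ltngtP i k) => // [ki|->].
    by rewrite -(subnSK ki).
  by rewrite subnn.
Qed.

Let N := #|{: 'I_n * 'I_n}|.

Definition mx_of_seq (x : nat -> R) : 'M[R]_n :=
  \matrix_(i, j) x (enum_rank (i, j)).

Lemma mx_of_seq_surj Q : exists y, mx_of_seq y = Q.
Proof.
exists (fun k => if (insub k : option 'I_N) is Some r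
  then entry (enum_val r) Q else 0).
apply/matrixP => i j; rewrite mxE.
by case: insubP => [r _ /val_inj ->|]; [rewrite enum_rankK|rewrite ltn_ord].
Qed.

Lemma semialg_exists_mx (P : (nat -> R) -> 'M[R]_n -> Prop) :
  semialg (fun x => P (fun i => x (N + i)%N) (mx_of_seq x)) ->
  semialg (fun x => exists Q, P x Q).
Proof.
move=> /(semialg_exists_block N); apply: semialg_ext => x.
have E y : (P (fun i => if (N + i < N)%N then y (N + i)%N else x (N + i - N)%N)
    (mx_of_seq (fun i => if (i < N)%N then y i else x (i - N)%N))) =
    P x (mx_of_seq y).
  congr P; first by apply/funext => i; rewrite ltnNge leq_addr addKn.
  by apply/matrixP => i j; rewrite !mxE ltn_ord.
split => [[y]|[Q PQ]]; first by rewrite E => ?; exists (mx_of_seq y).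
by have [y yQ] := mx_of_seq_surj Q; exists y; rewrite E yQ.
Qed.

Lemma semialg_forall_mx (P : (nat -> R) -> 'M[R]_n -> Prop) :
  semialg (fun x => P (fun i => x (N + i)%N) (mx_of_seq x)) ->
  semialg (fun x => forall Q, P x Q).
Proof.
move=> sP; apply: (@semialg_ext _ (fun x => ~ exists Q, ~ P x Q)).
  move=> x; split => [h Q|h [Q]]; last exact.
  by apply: contrapT => nP; apply: h; exists Q.
apply/semialg_not/(@semialg_exists_mx (fun x Q => ~ P x Q)).
exact: semialg_not.
Qed.

Definition semialg_family D :=
  semialg (fun x : nat -> R => D (x 0%N) (mx_of_seq (fun i => x i.+1))).

Lemma polyfun_mx_of_seq F (s : nat -> nat) : polyfun (@entry R n) F ->
  polyfun (@var R) (fun x => F (mx_of_seq (fun i => x (s i)))).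
Proof.
apply: polyfun_comp => -[i j]; rewrite /entry.
by under eq_fun do rewrite mxE; exact: pv.
Qed.

Lemma semialg_family_comp D a (s : nat -> nat) :
  semialg_family D -> polyfun (@var R) a ->
  semialg (fun x => D (a x) (mx_of_seq (fun i => x (s i)))).
Proof.
move=> sD pa.
apply: (@semialg_comp _ _ (fun x i => if i is j.+1 then x (s j) else a x) _ sD).
by case=> //= i; exact: pv.
Qed.

Definition argmins F D t : set 'M[R]_n :=
  [set Q | D t Q /\ forall Q', D t Q' -> F Q <= F Q'].

Lemma semialg_argmins F D : polyfun (@entry R n) F ->
  semialg_family D -> semialg_family (argmins F D).
Proof.
move=> pF sD; apply: semialg_and => //.
apply: (@semialg_forall_mx (fun x Q' => D (x 0%N) Q' ->
  F (mx_of_seq (fun i => x i.+1)) <= F Q')).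
apply: semialg_imp; first exact: (semialg_family_comp id sD (pv _)).
apply: semialg_le; first exact: (polyfun_mx_of_seq (fun i => N + i.+1)%N pF).
exact: (polyfun_mx_of_seq id pF).
Qed.

Lemma argmins_neq0 F D t : polyfun (@entry R n) F -> compact (D t) ->
  D t !=set0 -> argmins F D t !=set0.
Proof.
move=> pF cD D0.
have cF : {within D t, continuous F}.
  by apply: continuous_subspaceT; exact: polyfun_continuous.
have [c] := compact_EVT_min D0 cD cF; rewrite inE => Dc h.
by exists c; split=> // Q' DQ'; apply: h; rewrite inE.
Qed.

Lemma argmins_compact F D t : polyfun (@entry R n) F -> compact (D t) ->
  compact (argmins F D t).
Proof.
move=> pF cD; have [->|/set0P[c [Dc hc]]] := eqVneq (argmins F D t) set0.
  exact: compact0.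
rewrite (_ : argmins F D t = D t `&` F @^-1` [set x | x <= F c]).
  apply: compact_closedI => //.
  apply: closed_comp; last exact: closed_le.
  by move=> Q _; exact: polyfun_continuous.
apply/seteqP; split=> Q [DQ] /=; first by move/(_ c Dc).
by move=> Qc; split=> // Q' /hc; exact: le_trans.
Qed.

(** Minimizing the entries one after the other selects the lexicographically least matrix;
    compactness, preserved by [argmins], makes each minimum attained. *)
Lemma lex_argmins (s : seq ('I_n * 'I_n)) D :
  semialg_family D -> (forall t, compact (D t)) ->
  exists D', [/\ semialg_family D', forall t, D' t `<=` D t,
    forall t, D t !=set0 -> D' t !=set0 &
    forall t ij Q Q', ij \in s -> D' t Q -> D' t Q' ->
      entry ij Q = entry ij Q'].
Proof.
elim: s D => [|ij s ih] D sD cD.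
  by exists D; split=> [//|t Q|t|t kl Q Q'] //; rewrite in_nil.
have pe := polyfun_coord (@entry R n) ij.
have [D' [sD' subD' neD' hD']] := ih _ (semialg_argmins pe sD)
  (fun t => argmins_compact pe (cD t)).
exists D'; split=> // [t|t D0|t kl Q Q'].
- by apply: (subset_trans (subD' t)) => Q [].
- by apply: neD'; exact: argmins_neq0.
- rewrite inE => /predU1P[->|kls]; last exact: hD'.
  move=> /subD'[DQ hQ] /subD'[DQ' hQ'].
  by apply/le_anti; rewrite hQ ?hQ'.
Qed.

Lemma semialg_selection D : semialg_family D -> (forall t, compact (D t)) ->
  exists g : R -> 'M[R]_n, (forall t, D t !=set0 -> D t (g t)) /\
    forall F, polyfun (@entry R n) F -> semialg_fun (fun t => F (g t)).
Proof.
move=> sD cD.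
have [D' [sD' subD' neD' hD']] := lex_argmins (enum {: 'I_n * 'I_n}) sD cD.
have uniqD' t Q Q' : D' t Q -> D' t Q' -> Q = Q'.
  move=> DQ DQ'; apply/matrixP => i j.
  by apply: (hD' t (i, j)); rewrite ?mem_enum.
(* Where the set is empty [g] takes the value 0, so that its graph remains definable by a
   disjunction on [D' t !=set0]. *)
have /choice[g hg] t : exists Q, (D' t !=set0 -> D' t Q) /\
    (~ (D' t !=set0) -> Q = 0).
  have [[Q DQ]|D0] := pselect (D' t !=set0); last by exists 0.
  by exists Q; split => // /(_ (ex_intro _ Q DQ)).
exists g; split => [t /neD' D0|F pF].
  by apply: subD'; have [+ _] := hg t; exact.
have sE : semialg (fun x => D' (x 0%N) !=set0).
  apply: (@semialg_exists_mx (fun x => D' (x 0%N))).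
  exact: (semialg_family_comp id sD' (pv _)).
apply: (@semialg_ext _ (fun x =>
    (exists Q, D' (x 0%N) Q /\ x 1%N = F Q) \/
    (~ (D' (x 0%N) !=set0) /\ x 1%N = F 0))).
  move=> x; have [h1 h2] := hg (x 0%N); split.
    move=> [[Q [DQ ->]]|[D0 ->]]; last by rewrite h2.
    by congr F; apply: (uniqD' (x 0%N)) => //; apply: h1; exists Q.
  move=> ->; have [D0|D0] := pselect (D' (x 0%N) !=set0); [left|right].
    by exists (g (x 0%N)); split=> //; exact: h1.
  by rewrite h2.
apply: semialg_or.
  apply: (@semialg_exists_mx (fun x Q => D' (x 0%N) Q /\ x 1%N = F Q)).
  apply: semialg_and; first exact: (semialg_family_comp id sD' (pv _)).
  by apply: semialg_eq; [exact: pv|exact: (polyfun_mx_of_seq id pF)].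
apply: semialg_and; first exact: semialg_not.
by apply: semialg_eq; [exact: pv|exact: polyfun_const].
Qed.

End SemialgebraicSelection.

(** * The Lojasiewicz-type inequality *)

Section Desingularization.
Variable R : realType.

Lemma near_pos_all (I : finType) (P : I -> R -> Prop) :
  (forall i, near_pos (P i)) -> near_pos (fun u => forall i, P i u).
Proof.
move=> hP; suff h (s : seq I) : near_pos (fun u => forall i, i \in s -> P i u).
  by apply: near_pos_imp (h (enum I)) => u _ + i; apply; rewrite mem_enum.
elim: s => [|i s ih]; first by exists 1 => // u _ i; rewrite in_nil.
apply: near_pos_imp (near_pos_and (hP i) ih) => u _ [hi hs] j.
by rewrite inE => /predU1P[->//|]; exact: hs.
Qed.

(* Summing over a fine uniform partition removes the quadratic term, without
   any continuity of [V]. *)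
Lemma partition_bound (V : R -> R) (a b p C : R) : 0 <= p -> 0 <= C -> a < b ->
  (forall s t, a <= s -> s < t -> t <= b ->
     V s <= V t /\ t - s <= p * (V t - V s) + C * (V t - V s) ^+ 2) ->
  b - a <= p * (V b - V a).
Proof.
move=> p0 C0 ab H.
suff He (e : R) : 0 < e -> b - a <= (p + e) * (V b - V a).
  have [+ _] := H a b (lexx _) ab (lexx _); rewrite -subr_ge0 => L0.
  apply/ler_addgt0Pr => e e0.
  have := He (e / (V b - V a + 1)).
  rewrite divr_gt0// ?ltr_wpDl// => /(_ isT) h.
  apply: (le_trans h); rewrite mulrDl lerD2l mulrAC ler_pdivrMr ?ltr_wpDl//.
  by rewrite ler_pM2l// lerDl.
move=> e0.
(* Chosen so that the mesh satisfies [h * (C + 1) <= (p + e) * e]. On a cell where [V] grows by [D],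
   either [(C + 1) * D <= e] and the quadratic term is at most [e * D], or [(C + 1) * D > e] and
   [(p + e) * D] already exceeds [h]. *)
pose N := Num.truncn ((b - a) * (C + 1) / ((p + e) * e)).
pose h := (b - a) / N.+1%:R.
have pe0 : 0 < p + e by rewrite ltr_wpDl.
have C1 : 0 < C + 1 by rewrite ltr_wpDl.
have h0 : 0 < h by rewrite divr_gt0// subr_gt0.
have hN : N.+1%:R * h = b - a by rewrite mulrC divfK.
have he : h * (C + 1) <= (p + e) * e.
  rewrite /h mulrAC ler_pdivrMr// [leRHS]mulrC -ler_pdivrMr ?mulr_gt0//.
  by apply: ltW; exact: truncnS_gt.
have step s t : a <= s -> t <= b -> t - s = h -> h <= (p + e) * (V t - V s).
  move=> as_ tb ts; have st : s < t by rewrite -subr_gt0 ts.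
  have [+ hst] := H s t as_ st tb; rewrite -subr_ge0 => D0.
  rewrite ts in hst; set D := V t - V s in D0 hst *.
  have [CD|CD] := leP ((C + 1) * D) e.
    apply: (le_trans hst); rewrite mulrDl lerD2l expr2 mulrA ler_wpM2r//.
    by apply: le_trans CD; rewrite ler_wpM2r// lerDl.
  rewrite -(@ler_pM2r _ (C + 1))//; apply: (le_trans he).
  by rewrite -mulrA ler_pM2l// mulrC ltW.
have ind k : (k <= N.+1)%N ->
    k%:R * h <= (p + e) * (V (a + k%:R * h) - V a).
  elim: k => [|k ih] kN; first by rewrite !mul0r addr0 subrr mulr0.
  have /= hk := ih (ltnW kN).
  have : h <= (p + e) * (V (a + k.+1%:R * h) - V (a + k%:R * h)).
    apply: step.
    - by rewrite lerDl mulr_ge0// ltW.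
    - by rewrite addrC -lerBrDr -hN ler_pM2r// ler_nat.
    - by rewrite -natr1; ring.
  rewrite -natr1 => ?; lra.
by move: (ind N.+1 (leqnn _)); rewrite hN (addrC a) subrK.
Qed.

Lemma ler_entry_frob_norm p q (A : 'M[R]_(p, q)) i j : `|A i j| <= frob_norm A.
Proof.
rewrite -sqrtr_sqr; apply: ler_wsqrtr; rewrite /frob_dot (bigD1 i)//=.
rewrite (bigD1 j)//= -expr2 -addrA lerDl addr_ge0//.
  by apply: sumr_ge0 => k _; rewrite -expr2 sqr_ge0.
by apply: sumr_ge0 => k _; apply: sumr_ge0 => l _; rewrite -expr2 sqr_ge0.
Qed.

Lemma frob_norm_ge0 p q (A : 'M[R]_(p, q)) : 0 <= frob_norm A.
Proof. exact: sqrtr_ge0. Qed.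

Variable n : nat.
Implicit Types (Q : 'M[R]_n).

Lemma level_selection F (N : 'M[R]_n -> R) (c : R) :
  polyfun (@entry R n) F -> polyfun (@entry R n) N ->
  (forall d, 0 < d -> exists Q, [/\ On Q, 0 < c - F Q & c - F Q < d]) ->
  exists g : R -> 'M[R]_n,
    near_pos (fun t => [/\ On (g t), F (g t) = c - t &
      forall Q, On Q -> F Q = c - t -> N (g t) <= N Q]) /\
    forall G, polyfun (@entry R n) G -> semialg_fun (fun t => G (g t)).
Proof.
move=> pF pN hc; pose D t := [set Q | On Q /\ F Q = c - t].
have sD : semialg_family D.
  apply: semialg_and.
    (* Orthogonality as a single polynomial equation: the squared Frobenius norm of [E Q] is 0. *)
    pose E Q : 'M[R]_n := Q^T *m Q - 1%:M.
    have pE : polyfun (@entry R n) (fun Q => frob_dot (E Q) (E Q)).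
      have : mxpolyfun E; last by move=> pE; exact: polyfun_frob_dot.
      apply: mxpolyfunB; last exact: mxpolyfun_const.
      by apply: mxpolyfunM; first apply: mxpolyfun_tr; exact: mxpolyfun_id.
    apply: (@semialg_ext _ (fun x =>
      frob_dot (E (mx_of_seq n (fun i => x i.+1)))
      (E (mx_of_seq n (fun i => x i.+1))) = 0)).
      move=> x; set Q := mx_of_seq _ _; split => [/frob_dot_eq0/subr0_eq //|oQ].
      by rewrite /E (_ : Q^T *m Q = 1%:M)// subrr -(scale0r 0) frob_dotZl mul0r.
    apply: semialg_eq; last exact: polyfun_const.
    exact: (polyfun_mx_of_seq S pE).
  apply: semialg_eq; first exact: (polyfun_mx_of_seq S pF).
  apply: polyfunB; first exact: polyfun_const.
  exact: (polyfun_coord (@var R)).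
have cD t : compact (D t).
  rewrite (_ : D t = @On R n `&` F @^-1` [set x | x = c - t])//.
  apply: compact_closedI; first exact: On_compact.
  apply: closed_comp; last exact: closed_eq.
  by move=> Q _; exact: polyfun_continuous.
have [g [hg sg]] := semialg_selection (semialg_argmins pN sD)
  (fun t => argmins_compact pN (cD t)).
exists g; split=> //.
(* The hypothesis gives nonempty levels only for arbitrarily small [t]; the germ dichotomy upgrades
   this to all small [t]. *)
have : near_pos (fun t => D t !=set0).
  have sE : semialg (fun x : nat -> R => D (x 0%N) !=set0).
    apply: (@semialg_exists_mx _ _ (fun x => D (x 0%N))).
    exact: (semialg_family_comp id sD (polyfun_coord (@var R) _)).
  have [//|[d d0 hd]] := @semialg_near0 _ (fun t => D t !=set0) sE.
  have [Q [oQ Q0 Qd]] := hc d d0.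
  case: (hd (c - F Q)); first by rewrite Q0.
  by exists Q; split=> //; rewrite opprB addrC subrK.
apply: near_pos_imp => t _ D0.
have [[oQ FQ] h] := hg t (argmins_neq0 pN (cD t) D0).
by split=> // Q oQ' FQ'; apply: h.
Qed.

(** A Kurdyka-Lojasiewicz inequality in difference form, with [V] as desingularizing function. The
    hypothesis on small gradients makes the gradient norm along the selected curve nondecreasing. *)
Lemma desingularization F (c : R) : polyfun (@entry R n) F ->
  (forall d, 0 < d -> exists Q, [/\ On Q, 0 < c - F Q, c - F Q < d &
     frob_norm (proj_grad F Q) < d]) ->
  exists V : R -> R, exists2 d, 0 < d &
    (exists B, forall t, 0 < t < d -> `|V t| <= B) /\
    forall a b, 0 < a -> a < b -> b < d -> V a <= V b /\
      forall Q, On Q -> F Q = c - b ->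
        b - a <= frob_norm (proj_grad F Q) * (V b - V a).
Proof.
move=> pF hc.
have pP := mxpolyfun_proj_grad pF.
pose N Q := frob_dot (proj_grad F Q) (proj_grad F Q).
have pN : polyfun (@entry R n) N by exact: polyfun_frob_dot.
have [|g [hg sg]] := level_selection (c := c) pF pN.
  by move=> d /hc[Q [? ? ? _]]; exists Q.
(* [e] is the sign that turns the monotone entry into a nondecreasing one. *)
have mono (ij : 'I_n * 'I_n) : exists e : R, `|e| = 1 /\ near_pos (fun t =>
    forall s, 0 < s -> s < t -> e * entry ij (g s) <= e * entry ij (g t)).
  have [d d0 [h|h]] := semialg_fun_monotone (sg _ (polyfun_coord _ ij)).
    exists 1; split; first exact: normr1.
    by exists d => // t /andP[t0 td] s s0 st; rewrite !mul1r h.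
  exists (-1); split; first by rewrite normrN1.
  by exists d => // t /andP[t0 td] s s0 st; rewrite !mulN1r lerN2 h.
have [e he] := choice mono.
pose V t := \sum_ij e ij * entry ij (g t).
have /near_pos_all hmono := fun ij => (he ij).2.
have e1 ij := (he ij).1.
have nV t : On (g t) -> `|V t| <= #|{: 'I_n * 'I_n}|%:R.
  move=> og; rewrite (le_trans (ler_norm_sum _ _ _))//.
  rewrite -sum1_card natr_sum; apply: ler_sum => ij _.
  rewrite normrM e1 mul1r (le_trans (ler_entry_norm _ _ _))//.
  exact: On_norm_le1.
have [dpsi dpsi0 hpsi] := semialg_fun_monotone (sg N pN).
have [d d0 hd] := near_pos_and hg hmono.
have [C C0 hC] := On_taylor pF.
pose p t := frob_norm (proj_grad F (g t)).
exists V, (Num.min d dpsi); first by rewrite lt_min d0.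
split.
  exists #|{: 'I_n * 'I_n}|%:R => t; rewrite lt_min => /and3P[t0 td _].
  by apply: nV; have [|[]] := hd t; first exact/andP.
have Vmono s t : 0 < s -> s < t -> t < d ->
    (forall i j, `|(g s - g t) i j| <= V t - V s) /\
    (\sum_i \sum_j `|(g s - g t) i j| = V t - V s).
  move=> s0 st td.
  have E ij : `|(g s - g t) ij.1 ij.2| =
      e ij * entry ij (g t) - e ij * entry ij (g s).
    have [|_ /(_ ij s s0 st)] := hd t; first by rewrite td (lt_trans s0).
    rewrite -subr_ge0 => /ger0_norm <-; rewrite -mulrBr normrM e1 mul1r.
    by rewrite distrC !mxE.
  have E2 : \sum_i \sum_j `|(g s - g t) i j| = V t - V s.
    rewrite pair_big/= /V -sumrB; apply: eq_bigr => ij _; exact: E.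
  split=> // i j; rewrite -E2 (bigD1 i)//= (bigD1 j)//= -addrA lerDl.
  by rewrite addr_ge0// ?sumr_ge0// => k _; rewrite sumr_ge0.
(* Taylor's formula from [g t] to [g s], whose costs differ by exactly [t - s]. *)
have key s t : 0 < s -> s < t -> t < d ->
    V s <= V t /\ t - s <= p t * (V t - V s) + C * (V t - V s) ^+ 2.
  move=> s0 st td; have [h1 h2] := Vmono s t s0 st td.
  have VV : 0 <= V t - V s by rewrite -h2; do 2![apply: sumr_ge0 => ? _].
  split; first by rewrite -subr_ge0.
  have [|[os Fs _] _] := hd s; first by rewrite s0 (lt_trans st).
  have [|[ot Ft _] _] := hd t; first by rewrite td (lt_trans s0).
  have := hC _ _ ot os; rewrite Fs Ft.
  have -> : c - s - (c - t) = t - s by ring.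
  have hn : `|g s - g t| <= V t - V s by exact: mx_norm_le.
  have hD : `|frob_dot (proj_grad F (g t)) (g s - g t)| <= p t * (V t - V s).
    rewrite -h2 mulr_sumr (le_trans (ler_norm_sum _ _ _))// ler_sum// => i _.
    rewrite mulr_sumr (le_trans (ler_norm_sum _ _ _))// ler_sum// => j _.
    by rewrite normrM ler_wpM2r// ler_entry_frob_norm.
  have hS : C * `|g s - g t| ^+ 2 <= C * (V t - V s) ^+ 2.
    by rewrite ler_wpM2l// lerXn2r// nnegrE.
  move=> h3.
  have := le_trans (ler_norm _) (le_trans h3 hS).
  have := le_trans (ler_norm _) hD; lra.
(* In the nonincreasing case [N (g t)] is at most [N (g s)] for a level [s < t] containing a point
   of arbitrarily small gradient; by minimality [N (g s)] is as small, so [N (g t)] is 0. *)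
have pmono t b : 0 < t -> t < b -> b < d -> b < dpsi -> p t <= p b.
  move=> t0 tb bd bp; apply: ler_wsqrtr.
  case: hpsi => hpsi; first exact: hpsi.
  suff N0 : N (g t) = 0 by rewrite -/(N (g t)) N0 frob_dot_ge0.
  apply/le_anti; rewrite frob_dot_ge0 andbT.
  apply/ler_addgt0Pr => z z0; rewrite add0r.
  have m0 : 0 < Num.min t (Num.min 1 z) by rewrite !lt_min t0 ltr01.
  have [Q [oQ Q0 Qt Qz]] := hc _ m0.
  move: Qt Qz; rewrite !lt_min => /and3P[Qt _ _] /and3P[_ Q1 Qz].
  apply: (le_trans (hpsi _ _ Q0 Qt (lt_trans tb bp))).
  have [|[_ _ h] _] := hd (c - F Q); first by rewrite Q0; lra.
  apply: (le_trans (h Q oQ _)); first by rewrite opprB addrC subrK.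
  rewrite /N -sqr_frob_norm expr2 (le_trans _ (ltW Qz))//.
  by rewrite ler_piMl ?frob_norm_ge0// ltW.
move=> a b a0 ab; rewrite lt_min => /andP[bd bp].
split; first by have [] := key a b a0 ab bd.
move=> Q oQ FQ.
have pb : p b <= frob_norm (proj_grad F Q).
  apply: ler_wsqrtr; have [|[_ _ h] _] := hd b; last exact: h.
  by rewrite bd (lt_trans a0).
have Vab : 0 <= V b - V a by rewrite subr_ge0; have [] := key a b a0 ab bd.
apply: le_trans (ler_wpM2r Vab pb).
apply: (@partition_bound V a b (p b) C) => //; first exact: frob_norm_ge0.
move=> s t as_ st tb.
have s0 := lt_le_trans a0 as_; have td := le_lt_trans tb bd.
have [Vst h] := key s t s0 st td; split=> //.
apply: (le_trans h); rewrite lerD2r ler_wpM2r ?subr_ge0//.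
move: tb; rewrite le_eqVlt => /predU1P[->//|tb].
by apply: pmono => //; exact: lt_trans st.
Qed.

End Desingularization.

(** * Maximizing the cost along a rotation *)

Section AngularQuartics.
Variable R : realType.
Implicit Types (a b x y t u : R) (h : R -> R).

(** After a shift of the origin to [t], these are the value [a'] and the slope [b'] at a maximizer;
    comparison with the opposite point gives [0 <= a']. *)
Lemma sinusoid_maximizer a b t :
  (forall u, a * cos u + b * sin u <= a * cos t + b * sin t) ->
  b * cos t = a * sin t /\ 0 <= a * cos t + b * sin t.
Proof.
move=> tmax; pose a' := a * cos t + b * sin t; pose b' := b * cos t - a * sin t.
have cs := cos2Dsin2 t.
have shift w : a' * cos w + b' * sin w <= a'.
  by move: (tmax (t + w)); rewrite cosD sinD /a' /b'; lra.
have a'0 : 0 <= a' by move: (shift pi); rewrite cospi sinpi; lra.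
split=> //; apply/eqP; rewrite -subr_eq0 -/b'; apply/eqP.
(* The shifted inequality at the angle [2 * atan z], with cosine and sine written in terms of
   [z]. *)
have quad z : b' * z <= a' * z ^+ 2.
  have c0 : 0 < cos (atan z).
    by apply: cos_gt0_pihalf; rewrite atan_gtNpi2 atan_ltpi2.
  have zE : z * cos (atan z) = sin (atan z).
    by rewrite -{1}(atanK z) /tan divfK// gt_eqF.
  have := shift (atan z + atan z); rewrite cosD sinD -zE.
  have := cos2Dsin2 (atan z); rewrite -zE; set c := cos _ in c0 * => e.
  have {2}-> : a' = a' * (c ^+ 2 + (z * c) ^+ 2) by rewrite e mulr1.
  move=> hle; rewrite -(@ler_pM2r _ (c ^+ 2)) ?exprn_gt0//; lra.
(* The test point [b' / (a' + 1)] forces [b' = 0]; adding 1 covers the case [a' = 0]. *)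
have k0 : 0 < a' + 1 by rewrite ltr_wpDl.
have : b' ^+ 2 * (a' + 1) <= a' * b' ^+ 2.
  have := quad (b' / (a' + 1)).
  rewrite -(@ler_pM2r _ ((a' + 1) ^+ 2)) ?exprn_gt0//.
  rewrite [leLHS](_ : _ = b' ^+ 2 * (a' + 1)); last by field; rewrite gt_eqF.
  by rewrite [leRHS](_ : _ = a' * b' ^+ 2)//; field; rewrite gt_eqF.
move=> hb; have : b' ^+ 2 <= 0 by lra.
by move=> hb0; apply/eqP; rewrite -sqrf_eq0 eq_le hb0 sqr_ge0.
Qed.

(** A trigonometric polynomial of degree one in [4 * t], written in [cos t] and [sin t] so that it
    can be matched with the rotated cost; [a] is its value and [y] its slope at 0. *)
Definition angular_quartic a x y t :=
  a + x * (cos t * sin t) ^+ 2 +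
  y * (cos t * sin t * (cos t ^+ 2 - sin t ^+ 2)).

Lemma angular_quarticE a x y t : angular_quartic a x y t =
  a + x / 8 + ((- (x / 8)) * cos (t + t + (t + t)) +
    y / 4 * sin (t + t + (t + t))).
Proof.
rewrite /angular_quartic !(cosD, sinD).
have cs := cos2Dsin2 t; set c := cos t in cs *; set s := sin t in cs *.
have {1}-> : x / 8 = x / 8 * (c ^+ 2 + s ^+ 2) ^+ 2 by rewrite cs expr1n mulr1.
by field.
Qed.

Lemma angular_quartic0 a x y : angular_quartic a x y 0 = a.
Proof. by rewrite /angular_quartic sin0; ring. Qed.

Lemma angular_quartic_periodic a x y t :
  angular_quartic a x y (t - pi / 2) = angular_quartic a x y t.
Proof. by rewrite /angular_quartic cosBpihalf sinBpihalf; ring. Qed.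

(** A maximizer beyond [pi / 4] could be moved by a quarter turn to one closer to 0. *)
Lemma smallest_maximizer_pi4 a x y t :
  smallest_maximizer (angular_quartic a x y) t -> `|t| <= pi / 4.
Proof.
move=> [tmax tmin]; have p0 := @pi_gt0 R; rewrite leNgt; apply/negP => tp.
have [t0|t0] := leP 0 t.
- have /tmin : maximizer (angular_quartic a x y) (t - pi / 2).
    by move=> u; rewrite angular_quartic_periodic.
  rewrite ger0_norm// in tp *.
  by rewrite ler_normr => /orP[]; lra.
- have /tmin : maximizer (angular_quartic a x y) (t + pi / 2).
    by move=> u; rewrite -[leRHS]angular_quartic_periodic addrK.
  rewrite ltr0_norm// in tp *.
  by rewrite ler_normr => /orP[]; lra.
Qed.

(** With amplitude [A'], the gain is [A' * (1 - cos (4 * t))] and the slope at 0 is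
    [4 * A' * sin (4 * t)]. In terms of [c = cos t] and [s = sin t], the gain is
    [8 * A' * (c * s) ^+ 2] and the slope is [16 * A' * c * s * (c ^+ 2 - s ^+ 2)], whence the
    factors 2 and 32. *)
Lemma angular_quartic_smallest_maximizer a x y t M :
  smallest_maximizer (angular_quartic a x y) t ->
  (forall u, `|angular_quartic a x y u| <= M) ->
  let df := angular_quartic a x y t - a in
  [/\ 0 <= cos t, 0 <= df, `|y| * `|sin t| <= 2 * df, y ^+ 2 <= 32 * M * df &
      df = 0 -> t = 0].
Proof.
move=> tS hM df; have [tmax tmin] := tS; have p0 := @pi_gt0 R.
have tp := smallest_maximizer_pi4 tS.
have df0 : 0 <= df by rewrite subr_ge0 -[leLHS](angular_quartic0 a x y).
have c0 : 0 <= cos t.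
  by apply: cos_ge0_pihalf; move: tp; rewrite ler_norml; lra.
have c20 : 0 <= cos t ^+ 2 - sin t ^+ 2.
  rewrite !expr2 -cosD.
  by apply: cos_ge0_pihalf; move: tp; rewrite ler_norml; lra.
have [] := @sinusoid_maximizer (- (x / 8)) (y / 4) (t + t + (t + t)).
  move=> u; have := tmax (u / 4); rewrite !angular_quarticE.
  by rewrite (_ : u / 4 + u / 4 + (u / 4 + u / 4) = u) ?lerD2l//; field.
set C := cos (t + t + (t + t)); set S := sin (t + t + (t + t)).
set A' := _ + _ => B0 A'0.
have CS : C ^+ 2 + S ^+ 2 = 1 by exact: cos2Dsin2.
have AE : - (x / 8) = A' * C.
  rewrite /A'; move: B0; set A := - (x / 8); set B := y / 4 => B0.
  rewrite -[LHS]mulr1 -CS.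
  transitivity (A * C * C + (A * S) * S); first by ring.
  by rewrite -B0; ring.
have BE : y / 4 = A' * S.
  rewrite /A'; move: B0; set A := - (x / 8); set B := y / 4 => B0.
  rewrite -[LHS]mulr1 -CS.
  transitivity (B * C * C + B * S * S); first by ring.
  by rewrite B0; ring.
have dfE : df = A' * (1 - C).
  rewrite /df angular_quarticE -/C -/S -/A'.
  by move: AE; set k := x / 8 => AE; rewrite mulrBr mulr1 -AE; ring.
have cs := cos2Dsin2 t; set c := cos t in c0 c20 cs *.
set s := sin t in c20 cs *.
have CE : 1 - C = 8 * (c * s) ^+ 2.
  transitivity ((c ^+ 2 + s ^+ 2) ^+ 2 - C); first by rewrite cs expr1n.
  by rewrite /C !(cosD, sinD) -/c -/s; ring.
have SE : S = 4 * (c * s * (c ^+ 2 - s ^+ 2)).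
  by rewrite /S !(cosD, sinD) -/c -/s; ring.
have yE : y = 16 * A' * (c * s * (c ^+ 2 - s ^+ 2)).
  rewrite (_ : y = 4 * (y / 4)); last by field.
  by rewrite BE SE; ring.
rewrite CE in dfE.
have c1 : c <= 1 by exact: cos_le1.
have s2 : 0 <= s ^+ 2 by exact: sqr_ge0.
have s21 : s ^+ 2 <= 1 by rewrite -cs lerDr sqr_ge0.
(* The values at [t] and at [t + pi / 4] are the mean plus and minus [A']. *)
have A'M : A' <= M.
  have h1 := hM t; have h2 := hM (t + pi / 4).
  move: h1 h2; rewrite !angular_quarticE.
  rewrite (_ : t + pi / 4 + _ + _ = t + t + (t + t) + pi); last by field.
  rewrite sinDpi cosDpi -/C -/S !ler_norml !mulrN -opprD -/A'; lra.
split=> //.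
- rewrite yE dfE -normrM.
  have -> : 16 * A' * (c * s * (c ^+ 2 - s ^+ 2)) * s =
    16 * A' * c * s ^+ 2 * (c ^+ 2 - s ^+ 2) by ring.
  have -> : 2 * (A' * (8 * (c * s) ^+ 2)) = 16 * A' * c * s ^+ 2 * c by ring.
  have k0 : 0 <= 16 * A' * c * s ^+ 2 by do 3!rewrite mulr_ge0//.
  rewrite (ger0_norm (mulr_ge0 k0 c20)) ler_wpM2l//.
  have : 0 <= c * (1 - c) by rewrite mulr_ge0// subr_ge0.
  by move: s2; rewrite mulrBr mulr1 -expr2; lra.
- rewrite yE dfE.
  rewrite (_ : _ ^+ 2 =
    256 * (A' * (c * s) ^+ 2) * (A' * (c ^+ 2 - s ^+ 2) ^+ 2));
    last by ring.
  rewrite (_ : 32 * M * _ = 256 * (A' * (c * s) ^+ 2) * M); last by ring.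
  have k0 : 0 <= 256 * (A' * (c * s) ^+ 2).
    by do 2!rewrite mulr_ge0//; exact: sqr_ge0.
  rewrite ler_wpM2l// (le_trans _ A'M)// ler_piMr//.
  by rewrite expr_le1//; lra.
(* Without gain 0 is a maximizer too, and [t] has smallest magnitude. *)
- move=> df_eq0; apply/eqP; rewrite -normr_le0 -(normr0 R); apply: tmin => u.
  rewrite angular_quartic0; apply: (le_trans (tmax u)).
  by rewrite -subr_le0 -/df df_eq0.
Qed.

End AngularQuartics.

(** * Givens rotations and the estimates for one step *)

Section GivensSteps.
Variables (R : realType) (n : nat).
Implicit Types (Q M : 'M[R]_n) (i j : 'I_n) (t : R).

Lemma givensE i j t : (i < j)%N ->
  givens i j t = 1%:M + sin t *: (delta_mx j i - delta_mx i j) +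
    (cos t - 1) *: (delta_mx i i + delta_mx j j).
Proof.
move=> lt_ij.
have nij : (i == j) = false by apply/eqP => e; rewrite e ltnn in lt_ij.
have nji : (j == i) = false by rewrite eq_sym.
apply/matrixP => p q; rewrite !mxE.
have [->|pi] := eqVneq p i; have [->|qi] := eqVneq q i;
  rewrite ?nij ?nji ?eqxx /=.
- by rewrite mulr1n mulr0n; ring.
- by case: eqVneq => _ /=; rewrite ?(mulr0n, mulr1n, subr0, sub0r, addr0, add0r,
    mulr0, mulr1, mulrN).
- by rewrite andbF andbT (negPf pi); case: eqVneq => _ /=;
    rewrite ?(mulr0n, mulr1n, subr0, sub0r, addr0, add0r, mulr0, mulr1, mulrN).
- case: (eqVneq p j) => [->|pj] /=; last by rewrite ?mulr0n; ring.
  by case: eqVneq => _ /=; rewrite ?mulr0n ?mulr1n; ring.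
Qed.

Lemma givens0 i j : (i < j)%N -> givens i j 0 = 1%:M :> 'M[R]_n.
Proof.
by move=> ij; rewrite givensE// sin0 cos0 subrr !scale0r !addr0.
Qed.

Lemma givens_On i j t : (i < j)%N -> On (givens i j t).
Proof.
move=> lt_ij.
have nij : (i == j) = false by apply/eqP => e; rewrite e ltnn in lt_ij.
have nji : (j == i) = false by rewrite eq_sym.
rewrite /On/= givensE//.
set D : 'M[R]_n := delta_mx j i - delta_mx i j.
set E : 'M[R]_n := delta_mx i i + delta_mx j j.
have DT : D^T = - D by rewrite linearB/= !trmx_delta opprB.
have ET : E^T = E by rewrite linearD/= !trmx_delta.
have DD : D *m D = - E.
  rewrite /D mulmxBl !mulmxBr !mul_delta_mx !mul_delta_mx_0 ?nij ?nji//.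
  by rewrite sub0r subr0 /E opprD addrC.
have DE : D *m E = D.
  rewrite /D /E mulmxBl !mulmxDr !mul_delta_mx !mul_delta_mx_0 ?nij ?nji//.
  by rewrite addr0 add0r.
have ED : E *m D = D.
  rewrite /D /E mulmxDl !mulmxBr !mul_delta_mx !mul_delta_mx_0 ?nij ?nji//.
  by rewrite sub0r subr0 addrC.
have EE : E *m E = E.
  rewrite /E mulmxDl !mulmxDr !mul_delta_mx !mul_delta_mx_0 ?nij ?nji//.
  by rewrite addr0 add0r.
clearbody D E; set s := sin t; set c := cos t.
have -> : (1%:M + s *: D + (c - 1) *: E)^T = 1%:M - s *: D + (c - 1) *: E.
  by rewrite !linearD/= !linearZ/= trmx1 DT ET scalerN.
transitivity (1%:M + (c ^+ 2 + s ^+ 2 - 1) *: E); last first.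
  by rewrite cos2Dsin2 subrr scale0r addr0.
rewrite !(mulmxDl, mulmxDr, mulNmx, mul1mx, mulmx1) -!(scalemxAl, scalemxAr).
rewrite DD DE ED EE; apply/matrixP => p q; rewrite !mxE; ring.
Qed.

Lemma mulmx_deltaE M a b p k : (M *m (delta_mx a b : 'M[R]_n)) p k =
  M p a * (k == b)%:R.
Proof.
rewrite mxE (bigD1 a)//= mxE eqxx big1 ?addr0// => l la.
by rewrite mxE (negPf la) mulr0.
Qed.

Lemma mulmx_givensE M i j t p k : (i < j)%N -> (M *m givens i j t) p k =
  if k == i then cos t * M p i + sin t * M p j
  else if k == j then cos t * M p j - sin t * M p i else M p k.
Proof.
move=> lt_ij; rewrite givensE//.
have nij : (i == j) = false by apply/eqP => e; rewrite e ltnn in lt_ij.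
have nji : (j == i) = false by rewrite eq_sym.
rewrite !(mulmxDr, mulmxBr, mulmx1) -!scalemxAr.
rewrite !(mulmxDr, mulmxN) !mxE.
have E a b : \sum_l M p l * (delta_mx a b : 'M[R]_n) l k = M p a * (k == b)%:R.
  by rewrite -mulmx_deltaE mxE.
rewrite !E; case: (eqVneq k i) => [->|ki].
  by rewrite nij mulr1n mulr0n; ring.
case: (eqVneq k j) => [->|kj]; rewrite mulr0n ?mulr1n; ring.
Qed.

Lemma givens_norm_le i j t : (i < j)%N -> 0 <= cos t ->
  `|givens i j t - 1%:M : 'M[R]_n| <= `|sin t|.
Proof.
move=> lt_ij c0; rewrite givensE//.
have nij : (i == j) = false by apply/eqP => e; rewrite e ltnn in lt_ij.
have nji : (j == i) = false by rewrite eq_sym.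
have c1 : `|cos t - 1| <= `|sin t|.
  have := cos2Dsin2 t; rewrite -[sin t ^+ 2]real_normK ?num_real//.
  have s0 := normr_ge0 (sin t).
  have s1 : `|sin t| <= 1 by rewrite ler_norml sin_le1 sin_geN1.
  have cle := cos_le1 t.
  have -> : `|cos t - 1| = 1 - cos t by rewrite ler0_norm ?subr_le0// opprB.
  move=> cs.
  have : 0 <= `|sin t| * (1 - `|sin t|) by rewrite mulr_ge0// subr_ge0.
  have : 0 <= cos t * (1 - cos t) by rewrite mulr_ge0// subr_ge0.
  rewrite !mulrBr !mulr1 -!expr2; lra.
apply: mx_norm_le => // p q; rewrite !mxE.
have [->|pi] := eqVneq p i; have [->|qi] := eqVneq q i;
  rewrite ?nij ?nji ?eqxx /=.
- by rewrite mulr0n subrr mulr0 !addr0 mulr1 addrC addKr.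
- rewrite mulr0n sub0r !(addr0, add0r) mulr0 addr0 subr0.
  by case: eqVneq => _; rewrite ?mulrN ?normrN ?mulr1 ?mulr0 ?normr0.
- rewrite (negPf pi) mulr0n andbT andbF subr0 !(addr0, add0r) mulr0 addr0 subr0.
  by case: eqVneq => _; rewrite ?mulr1 ?mulr0 ?normr0.
- rewrite !andbF subr0 mulr0 addr0 add0r.
  rewrite (addrC (p == q)%:R) addrK.
  by case: (_ && _); rewrite ?mulr1 ?mulr0 ?normr0.
Qed.

Definition givens_quartic (F : 'M[R]_n -> R) := forall Q i j, (i < j)%N ->
  exists a x y, forall t, F (Q *m givens i j t) = angular_quartic a x y t.

(** Both sides are the derivative at angle 0. Taylor's formula on the chord is compared with the
    explicit quartic at [sin t = s], and the difference divided by [s] tends to 0. *)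
Lemma givens_slope F Q i j a x y : polyfun (@entry R n) F -> On Q ->
  (i < j)%N -> (forall t, F (Q *m givens i j t) = angular_quartic a x y t) ->
  y = frob_dot (proj_grad F Q) (tangent_dir i j Q).
Proof.
move=> pF oQ ij hF; have [C C0 hC] := On_taylor pF.
set p := frob_dot _ _.
have AB (A B : 'M[R]_n) k : (A^T *m B) k k = (B^T *m A) k k.
  by rewrite !mxE; apply: eq_bigr => l _; rewrite !mxE mulrC.
have LE k : Lambda F Q k k = 0.
  by rewrite /Lambda mxE [X in _ * X]mxE [X in _ + X]mxE AB subrr mulr0.
have QD M N : frob_dot (Q *m M) (Q *m N) = frob_dot M N.
  rewrite !frob_dot_mxtrace trmx_mul mulmxA -(mulmxA M^T).
  by rewrite (_ : Q^T *m Q = 1%:M)// mulmx1.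
(* The [cos t - 1] part of the rotation is diagonal, and [Lambda] is skew, hence has zero
   diagonal. *)
have chord t : frob_dot (proj_grad F Q) (Q *m givens i j t - Q) = sin t * p.
  rewrite -[X in _ - X]mulmx1 -mulmxBr QD givensE//.
  rewrite -(addrA 1%:M) (addrC 1%:M) addrK frob_dotDr !frob_dotZr.
  rewrite [frob_dot _ (delta_mx i i + _)]frob_dotDr.
  rewrite !frob_dot_delta_mx !LE addr0 mulr0 addr0.
  by rewrite /p /tangent_dir QD delta_givensE.
(* The constant collects the Taylor remainder, the [x] term, and the deviation of
   [c * (c ^+ 2 - s ^+ 2)] from 1, which is at most [3 * s]. *)
have bound s : 0 < s <= 1 ->
    `|y - p| <= (C * n%:R ^+ 2 + `|x| + 3 * `|y|) * s.
  move=> /andP[/[dup] s0 /ltW s0' s1]; pose t := asin s.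
  have sI : -1 <= s <= 1 by rewrite s1 (le_trans _ (ltW s0))// lerN10.
  have st : sin t = s by rewrite /t asinK// in_itv.
  have c0 : 0 <= cos t by rewrite /t cos_asin// sqrtr_ge0.
  have cs := cos2Dsin2 t; rewrite st in cs.
  have := hC _ _ oQ (On_mulmx oQ (givens_On t ij)).
  rewrite hF -{1}[Q]mulmx1 -(givens0 ij) hF angular_quartic0 chord st.
  have dQ : `|Q *m givens i j t - Q| <= n%:R * s.
    rewrite -[X in _ - X]mulmx1 -mulmxBr (le_trans (mulmx_norm_le _ _))//.
    rewrite ler_wpM2l// -[leRHS]mul1r ler_pM// ?On_norm_le1//.
    by rewrite (le_trans (givens_norm_le ij c0))// st gtr0_norm.
  move=> h; have {h dQ} : `|x * (cos t * s) ^+ 2 +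
      y * (cos t * s * (cos t ^+ 2 - s ^+ 2)) - s * p| <= C * (n%:R * s) ^+ 2.
    rewrite (_ : _ + _ - _ = angular_quartic a x y t - a - s * p).
      by rewrite (le_trans h)// ler_wpM2l// lerXn2r ?nnegrE// mulr_ge0// ltW.
    by rewrite /angular_quartic st; ring.
  set c := cos t in c0 cs *; have c1 : c <= 1 by exact: cos_le1.
  rewrite (_ : _ - s * p = s * ((y - p) + x * (c ^+ 2 * s) -
    y * (1 - c * (c ^+ 2 - s ^+ 2)))); last by ring.
  rewrite (_ : C * _ = s * (C * n%:R ^+ 2 * s)); last by ring.
  rewrite normrM gtr0_norm// ler_pM2l// => h.
  have hx : `|x * (c ^+ 2 * s)| <= `|x| * s.
    have cs0 : 0 <= c ^+ 2 * s by rewrite mulr_ge0 ?sqr_ge0.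
    by rewrite normrM ler_wpM2l// (ger0_norm cs0) ler_piMl// expr_le1.
  have hy : `|y * (1 - c * (c ^+ 2 - s ^+ 2))| <= 3 * `|y| * s.
    rewrite normrM mulrAC mulrC ler_wpM2r// ler_norml.
    have e1 : 0 <= c * (1 - c) by rewrite mulr_ge0// subr_ge0.
    have e2 : 0 <= s * (1 - s) by rewrite mulr_ge0// ?subr_ge0// ltW.
    have e3 : 0 <= (1 - c) * s ^+ 2 by rewrite mulr_ge0 ?subr_ge0 ?sqr_ge0.
    have e4 : 0 <= c * s ^+ 2 by rewrite mulr_ge0 ?sqr_ge0.
    have -> : 1 - c * (c ^+ 2 - s ^+ 2) = 1 - c + 2 * (c * s ^+ 2).
      rewrite (_ : c ^+ 2 = 1 - s ^+ 2); last by rewrite -cs addrK.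
      by ring.
    move: e1 e2 e3 cs; rewrite !(mulrBr, mulrBl, mul1r, mulr1) -!expr2.
    by move=> *; apply/andP; split; lra.
  rewrite 2!mulrDl.
  rewrite (_ : y - p = ((y - p) + x * (c ^+ 2 * s) -
    y * (1 - c * (c ^+ 2 - s ^+ 2))) - x * (c ^+ 2 * s) +
    y * (1 - c * (c ^+ 2 - s ^+ 2))); last by ring.
  rewrite (le_trans (ler_normD _ _))// lerD//.
  by rewrite (le_trans (ler_normB _ _))// lerD.
suff: `|y - p| <= 0 by rewrite normr_le0 subr_eq0 => /eqP.
apply/ler_addgt0Pr => e e0.
rewrite add0r; set K := _ + _ + _ in bound.
have K0 : 0 <= K by rewrite ?(addr_ge0, mulr_ge0, exprn_ge0).
have K1 : 0 < K + 1 by rewrite ltr_wpDl.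
have s0 : 0 < Num.min 1 (e / (K + 1)) by rewrite lt_min ltr01 divr_gt0.
apply: (le_trans (bound (Num.min 1 (e / (K + 1))) _)).
  by rewrite s0 ge_min lexx.
rewrite (@le_trans _ _ (K * (e / (K + 1))))//.
  by rewrite ler_wpM2l// ge_min lexx orbT.
by rewrite mulrA ler_pdivrMr// mulrC ler_pM2l// lerDl.
Qed.

Lemma jacobiG_step_bounds F eps : polyfun (@entry R n) F -> givens_quartic F ->
  0 < eps -> exists2 K, 0 < K & forall Q Q', On Q -> jacobiG_step F eps Q Q' ->
    [/\ On Q', F Q <= F Q',
        eps * frob_norm (proj_grad F Q) * `|Q' - Q| <= K * (F Q' - F Q),
        (eps * frob_norm (proj_grad F Q)) ^+ 2 <= K * (F Q' - F Q) &
        F Q' = F Q -> Q' = Q].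
Proof.
move=> pF qF e0; have [M M0 hM] := polyfun_bounded_On pF.
(* [2 * n%:R] serves the step length, as [Q' - Q] is at most [n%:R] times the sine of the angle;
   [32 * M] serves the squared gradient; 1 makes the constant positive. *)
exists (2 * n%:R + 32 * M + 1).
  by rewrite ltr_wpDl// addr_ge0// mulr_ge0.
move=> Q Q' oQ [i [j [t [ij hy tS ->]]]].
have [a [x [y hF]]] := qF Q i j ij.
have FQ : F Q = a by rewrite -{1}[Q]mulmx1 -(givens0 ij) hF angular_quartic0.
have oQt u : On (Q *m givens i j u) by exact: On_mulmx (givens_On u ij).
rewrite (_ : (fun u => _) = angular_quartic a x y) in tS; last exact/funext.
have hM' u : `|angular_quartic a x y u| <= M by rewrite -hF hM.
have [c0 df0 h1 h2 h3] := angular_quartic_smallest_maximizer tS hM'.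
rewrite -(givens_slope pF oQ ij hF) in hy.
rewrite hF FQ; set df := angular_quartic a x y t - a in df0 h1 h2 h3 *.
have P0 := frob_norm_ge0 (proj_grad F Q).
have eP0 : 0 <= eps * frob_norm (proj_grad F Q) by rewrite mulr_ge0// ltW.
have dQ : `|Q *m givens i j t - Q| <= n%:R * `|sin t|.
  rewrite -[X in _ - X]mulmx1 -mulmxBr (le_trans (mulmx_norm_le _ _))//.
  rewrite ler_wpM2l// -[leRHS]mul1r ler_pM// ?On_norm_le1//.
  exact: givens_norm_le.
have Mdf : 0 <= M * df by rewrite mulr_ge0.
have ndf : 0 <= n%:R * df by rewrite mulr_ge0.
split=> //; first by rewrite -subr_ge0.
- rewrite (@le_trans _ _ (`|y| * (n%:R * `|sin t|)))//.
    by rewrite ler_pM.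
  rewrite mulrCA (@le_trans _ _ (n%:R * (2 * df)))//.
    by rewrite ler_wpM2l.
  by rewrite !mulrDl mul1r; lra.
- rewrite (@le_trans _ _ (y ^+ 2))//.
    by rewrite -[leRHS]real_normK ?num_real// lerXn2r// nnegrE.
  by rewrite (le_trans h2)// !mulrDl mul1r; lra.
- by move=> /eqP; rewrite -subr_eq0 => /eqP/h3 ->; rewrite givens0// mulmx1.
Qed.

End GivensSteps.

(** * Convergence of the iterates *)

Section Convergence.
Variables (R : realType) (n : nat).
Implicit Types (Q : nat -> 'M[R]_n) (F : 'M[R]_n -> R).

Lemma cvg_entries Q (Qs : 'M[R]_n) :
  (forall i j, Q k i j @[k --> \oo] --> Qs i j) -> Q @ \oo --> Qs.
Proof.
move=> h; apply/cvgrPdist_le => e e0.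
have : \forall k \near \oo, forall ij : 'I_n * 'I_n,
    `|Qs ij.1 ij.2 - Q k ij.1 ij.2| <= e.
  by apply: filter_forall => ij; have /cvgrPdist_le/(_ e e0) := h ij.1 ij.2.
apply: filterS => k hk; apply: mx_norm_le => [|i j]; first exact: ltW.
by rewrite !mxE; exact: (hk (i, j)).
Qed.

Lemma bounded_variation_cvg Q (W : nat -> R) (B : R) : (forall k, On (Q k)) ->
  (forall k, `|Q k.+1 - Q k| <= W k - W k.+1) -> (forall k, - B <= W k) ->
  exists Qs : 'M[R]_n, Q @ \oo --> Qs.
Proof.
move=> oQ dQ hB.
have mono (u : nat -> R) b : (forall k, u k.+1 <= u k) ->
    (forall k, b <= u k) -> cvgn u.
  move=> h1 h2; apply: nonincreasing_is_cvgn.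
    exact/nonincreasing_seqP.
  by exists b => _ [k _ <-]; exact: h2.
have cW : cvgn W.
  apply: mono hB => k; rewrite -subr_ge0; exact: le_trans (dQ k).
have cQ i j : cvgn (fun k => Q k i j).
  (* Adding [W] makes the entry nonincreasing, since no increment of the entry exceeds the decrement
     of [W]. *)
  have -> : (fun k => Q k i j) = (fun k => Q k i j + W k) - W.
    by apply/funext => k /=; rewrite fctE addrK.
  apply: is_cvgB => //; apply: (mono _ (- 1 - B)) => k.
    have := le_trans (ler_entry_norm (Q k.+1 - Q k) i j) (dQ k).
    by rewrite !mxE => /(le_trans (ler_norm _)); lra.
  rewrite lerD//.
  have := le_trans (ler_entry_norm (Q k) i j) (On_norm_le1 (oQ k)).
  by rewrite ler_norml => /andP[].
exists (\matrix_(i, j) limn (fun k => Q k i j)).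
by apply: cvg_entries => i j; rewrite mxE; exact: cQ.
Qed.

Lemma jacobiG_cvg F (eps : R) (Q0 : 'M[R]_n) Q :
  polyfun (@entry R n) F -> givens_quartic F -> 0 < eps ->
  On Q0 -> jacobiG F eps Q0 Q ->
  exists Qs : 'M[R]_n, [/\ Q @ \oo --> Qs, On Qs & stationary F Qs].
Proof.
move=> pF qF e0 oQ0 [Q00 stepQ].
have [K K0 hK] := jacobiG_step_bounds pF qF e0.
have oQ k : On (Q k).
  by elim: k => [|k ih]; [rewrite Q00|have [] := hK _ _ ih (stepQ k)].
pose u k := F (Q k); pose P k := frob_norm (proj_grad F (Q k)).
have P0 k : 0 <= P k by exact: frob_norm_ge0.
have [M M0 hM] := polyfun_bounded_On pF.
have umono : nondecreasing_seq u.
  by apply/nondecreasing_seqP => k; have [] := hK _ _ (oQ k) (stepQ k).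
have cu : cvgn u.
  apply: nondecreasing_is_cvgn => //.
  by exists M => _ [k _ <-]; exact: le_trans (ler_norm _) (hM _ (oQ k)).
set c := limn u; have uc k : u k <= c by exact: nondecreasing_cvgn_le.
have ducvg : (fun k => K * (u k.+1 - u k)) @ \oo --> 0.
  rewrite -(mulr0 K) -(subrr c); apply: cvgMr; apply: cvgB => //.
  by rewrite (cvg_shiftS u).
(* Any limit is stationary: the squared gradient is squeezed between 0 and a multiple of the cost
   increments, which tend to 0. *)
have stat (Qs : 'M[R]_n) :
    Q @ \oo --> Qs -> [/\ Q @ \oo --> Qs, On Qs & stationary F Qs].
  move=> cQ; split=> //.
    by apply: (closed_cvg _ (@On_closed R n) _ _ cQ);
      apply: nearW => k; exact: oQ.
  pose N X := frob_dot (proj_grad F X) (proj_grad F X).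
  have pN : polyfun (@entry R n) N.
    by apply: polyfun_frob_dot; exact: mxpolyfun_proj_grad.
  have cN : (fun k => eps ^+ 2 * N (Q k)) @ \oo --> eps ^+ 2 * N Qs.
    apply: cvgMr; apply: (@cvg_comp _ _ _ Q N _ (nbhs Qs)) => //.
    exact: polyfun_continuous.
  have cN0 : (fun k => eps ^+ 2 * N (Q k)) @ \oo --> 0.
    apply: (@squeeze_cvgr _ _ _ _ (fun=> 0)
      (fun k => K * (u k.+1 - u k))) => //.
      apply: nearW => k; rewrite mulr_ge0 ?sqr_ge0 ?frob_dot_ge0//=.
      have [_ _ _ + _] := hK _ _ (oQ k) (stepQ k).
      by rewrite exprMn sqr_frob_norm.
    exact: cvg_cst.
  have /eqP : eps ^+ 2 * N Qs = 0.
    by rewrite -(cvg_lim _ cN)// (cvg_lim _ cN0).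
  by rewrite mulf_eq0 expf_eq0 gt_eqF//= => /eqP/frob_dot_eq0.
suff [k1 [W [B [hW hB]]]] : exists k1 (W : nat -> R) B,
    (forall k, `|Q (k + k1).+1 - Q (k + k1)%N| <= W k - W k.+1) /\
    (forall k, - B <= W k).
  have [Qs cQ] := bounded_variation_cvg (fun k => oQ (k + k1)%N) hW hB.
  by exists Qs; apply: stat; rewrite -(cvg_shiftn k1).
(* [V] is controlled only at positive arguments. If the limit value is reached, the cost no longer
   grows and the iterates stay fixed; otherwise [c - u k] is always positive. *)
have [[k0 uk0]|nuc] := pselect (exists k0, u k0 = c).
  exists k0, (fun=> 0), 0; split=> [k|k]; last by rewrite oppr0.
  have e1 l : (k0 <= l)%N -> u l = c.
    by move=> kl; apply/le_anti; rewrite uc -uk0 umono.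
  have [_ _ _ _ ->] := hK _ _ (oQ (k + k0)%N) (stepQ (k + k0)%N).
    by rewrite !subrr normr0.
  by rewrite -/(u _) -/(u _) !e1 ?leq_addl// leqW// leq_addl.
have {}uc k : u k < c.
  rewrite lt_neqAle uc andbT; apply/eqP => ukc; apply: nuc; by exists k.
have near_c d : 0 < d -> exists k, forall l, (k <= l)%N -> c - u l < d.
  move=> d0; have /cvgrPdist_lt/(_ d d0)[k _ hk] := cu.
  by exists k => l kl; apply: le_lt_trans (ler_norm _) (hk l kl).
(* A late iterate supplies the required point: its level is close to [c], and its next cost
   increment is so small that the gradient is below [d]. *)
have [|V [d d0 [[B hB] hV]]] := @desingularization R n F c pF.
  move=> d d0; have [k hk] := near_c d d0.
  have ed0 : 0 < (eps * d) ^+ 2 by rewrite exprn_gt0// mulr_gt0.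
  have /cvgrPdist_lt/(_ _ ed0)[l _ hl] := ducvg.
  have kl : (k <= maxn k l)%N by rewrite leq_max leqnn.
  have ll : (l <= maxn k l)%N by rewrite leq_max leqnn orbT.
  move: kl ll; set m := maxn k l => km lm; exists (Q m); split=> //.
  - by rewrite subr_gt0; exact: uc.
  - exact: hk.
  - have eP : 0 <= eps * frob_norm (proj_grad F (Q m)).
      by rewrite mulr_ge0 ?frob_norm_ge0// ltW.
    have ed : 0 <= eps * d by rewrite mulr_ge0// ltW.
    rewrite -(ltr_pM2l e0) -(@ltr_pXn2r _ 2)//.
    have [_ _ _ + _] := hK _ _ (oQ m) (stepQ m); move/le_lt_trans; apply.
    have := hl m lm; rewrite sub0r normrN; exact: le_lt_trans (ler_norm _).
have [k1 hk1] := near_c d d0.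
(* The step estimate is [eps * P l * |Q_(l+1) - Q_l| <= K * (u l.+1 - u l)], and the increment is at
   most [P l] times that of [V]; cancelling [P l] leaves [K / eps]. *)
pose L := K / eps; have L0 : 0 < L by rewrite divr_gt0.
exists k1, (fun k => L * V (c - u (k + k1)%N)), (L * B); split=> k; last first.
  rewrite -mulrN ler_pM2l//.
  have /hB : 0 < c - u (k + k1)%N < d by rewrite subr_gt0 uc hk1// leq_addl.
  by rewrite ler_norml => /andP[].
rewrite addSn; set l := (k + k1)%N; have k1l : (k1 <= l)%N by exact: leq_addl.
have [_ h1 h2 _ h3] := hK _ _ (oQ l) (stepQ l).
have [ul|ul] := eqVneq (u l.+1) (u l).
  by rewrite h3// subrr normr0 ul subrr.
have ltu : u l < u l.+1 by rewrite lt_neqAle eq_sym ul.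
have [||| Vab /(_ (Q l) (oQ l))] := hV (c - u l.+1) (c - u l).
- by rewrite subr_gt0.
- by rewrite ltrD2l ltrN2.
- exact: hk1.
rewrite opprB addrC subrK => /(_ erefl).
rewrite -/(P l) in h2 *; rewrite (_ : _ - _ - _ = u l.+1 - u l); last by ring.
move=> h4; rewrite -mulrBr.
(* A zero gradient would contradict the strict growth of the cost, by the inequality [h4]. *)
have Pl : 0 < P l.
  rewrite lt_neqAle P0 andbT; apply/eqP => Pl0; move: h4.
  by rewrite -Pl0 mul0r subr_le0 leNgt ltu.
rewrite -(@ler_pM2l _ (eps * P l)) ?mulr_gt0//; apply: (le_trans h2).
rewrite (_ : eps * P l * _ = K * (P l * (V (c - u l) - V (c - u l.+1)))).
  by rewrite ler_pM2l.
by rewrite /L; field; rewrite gt_eqF.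
Qed.

End Convergence.

(** * The two cost functions along a Givens rotation *)

Section CostFunctions.
Variables (R : realType) (n : nat).

Lemma givens_quartic_sum (I : finType) (F : I -> 'M[R]_n -> R) :
  (forall l, givens_quartic (F l)) -> givens_quartic (fun Q => \sum_l F l Q).
Proof.
move=> hF Q i j ij.
have /choice[p hp] l : exists p : R * R * R, forall t,
    F l (Q *m givens i j t) = angular_quartic p.1.1 p.1.2 p.2 t.
  by have [a [x [y h]]] := hF l Q i j ij; exists (a, x, y).
exists (\sum_l (p l).1.1), (\sum_l (p l).1.2), (\sum_l (p l).2) => t.
rewrite /angular_quartic !mulr_suml -!big_split/=.
by apply: eq_bigr => l _; rewrite hp.
Qed.

(** A Givens rotation mixes only columns [i] and [j]; the other columns contribute to the constant
    term. *)
Lemma givens_quartic_columns (phi : ('I_n -> R) -> R) :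
  (forall v w : 'I_n -> R, exists a x y, forall t,
     phi (fun p => cos t * v p + sin t * w p) +
     phi (fun p => - sin t * v p + cos t * w p) = angular_quartic a x y t) ->
  givens_quartic (fun Q : 'M[R]_n => \sum_k phi (fun p => Q p k)).
Proof.
move=> hphi Q i j ij.
have ji : j != i by apply/eqP => e; rewrite e ltnn in ij.
have [a [x [y h]]] := hphi (fun p => Q p i) (fun p => Q p j).
exists (a + \sum_(k | (k != i) && (k != j)) phi (fun p => Q p k)), x, y => t.
rewrite (bigD1 i)//= (bigD1 j)//= addrA.
transitivity (angular_quartic a x y t +
  \sum_(k | (k != i) && (k != j)) phi (fun p => Q p k)); last first.
  by rewrite /angular_quartic; ring.
rewrite -h; congr (_ + _ + _).
- by congr phi; apply/funext => p; rewrite mulmx_givensE// eqxx.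
- congr phi; apply/funext => p; rewrite mulmx_givensE// (negPf ji) eqxx.
  by rewrite mulNr addrC.
- apply: eq_bigr => k /andP[ki kj]; congr phi; apply/funext => p.
  by rewrite mulmx_givensE// (negPf ki) (negPf kj).
Qed.

(** With c and s the cosine and sine of t, two rotated columns contribute g(c,s)^2 + g(-s,c)^2. A
    quarter turn exchanges the two squares, so among the frequencies 0, 2, 4, 6 allowed by the
    degree only 0 and 4 survive. For quadratic forms the same holds among 0, 2, 4. *)
Definition binary_cubic (g : R -> R -> R) := exists a b c d, forall x y,
  g x y = a * x ^+ 3 + b * (x ^+ 2 * y) + c * (x * y ^+ 2) + d * y ^+ 3.

Definition binary_quadratic (g : R -> R -> R) := exists a b c, forall x y,
  g x y = a * x ^+ 2 + b * (x * y) + c * y ^+ 2.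

Lemma binary_cubic_sum (I : finType) (g : I -> R -> R -> R) :
  (forall l, binary_cubic (g l)) -> binary_cubic (fun x y => \sum_l g l x y).
Proof.
move=> hg.
have /choice[p hp] l : exists p : R * R * (R * R), forall x y, g l x y =
    p.1.1 * x ^+ 3 + p.1.2 * (x ^+ 2 * y) + p.2.1 * (x * y ^+ 2) +
    p.2.2 * y ^+ 3.
  by have [a [b [c [d h]]]] := hg l; exists ((a, b), (c, d)).
exists (\sum_l (p l).1.1), (\sum_l (p l).1.2), (\sum_l (p l).2.1),
  (\sum_l (p l).2.2) => x y.
by rewrite !mulr_suml -!big_split/=; apply: eq_bigr => l _; rewrite hp.
Qed.

Lemma binary_quadratic_sum (I : finType) (g : I -> R -> R -> R) :
  (forall l, binary_quadratic (g l)) ->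
  binary_quadratic (fun x y => \sum_l g l x y).
Proof.
move=> hg.
have /choice[p hp] l : exists p : R * R * R, forall x y, g l x y =
    p.1.1 * x ^+ 2 + p.1.2 * (x * y) + p.2 * y ^+ 2.
  by have [a [b [c h]]] := hg l; exists (a, b, c).
exists (\sum_l (p l).1.1), (\sum_l (p l).1.2), (\sum_l (p l).2) => x y.
by rewrite !mulr_suml -!big_split/=; apply: eq_bigr => l _; rewrite hp.
Qed.

(* Both sides are made homogeneous in [cos t] and [sin t] before comparing
   coefficients. *)
Lemma binary_cubic_angular g : binary_cubic g -> exists a x y, forall t,
  g (cos t) (sin t) ^+ 2 + g (- sin t) (cos t) ^+ 2 = angular_quartic a x y t.
Proof.
move=> [a [b [c [d h]]]].
(* The outer two are the value and the slope at 0; the middle one comes from matching the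
   coefficient of [x ^+ 4 * y ^+ 2]. *)
exists (a ^+ 2 + d ^+ 2), (b ^+ 2 + c ^+ 2 + 2 * a * c + 2 * b * d
  - 3 * (a ^+ 2 + d ^+ 2)), (2 * a * b - 2 * c * d) => t.
rewrite !h /angular_quartic; have := cos2Dsin2 t.
set x := cos t; set y := sin t; move=> xy.
transitivity ((a ^+ 2 + d ^+ 2) * (x ^+ 2 + y ^+ 2) ^+ 3 +
  (b ^+ 2 + c ^+ 2 + 2 * a * c + 2 * b * d - 3 * (a ^+ 2 + d ^+ 2)) *
    (x * y) ^+ 2 * (x ^+ 2 + y ^+ 2) +
  (2 * a * b - 2 * c * d) * (x * y * (x ^+ 2 - y ^+ 2)) * (x ^+ 2 + y ^+ 2)).
  by ring.
by rewrite xy expr1n !mulr1.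
Qed.

Lemma binary_quadratic_angular g : binary_quadratic g -> exists a x y, forall t,
  g (cos t) (sin t) ^+ 2 + g (- sin t) (cos t) ^+ 2 = angular_quartic a x y t.
Proof.
move=> [a [b [c h]]].
exists (a ^+ 2 + c ^+ 2), (2 * b ^+ 2 + 4 * a * c - 2 * (a ^+ 2 + c ^+ 2)),
  (2 * a * b - 2 * b * c) => t.
rewrite !h /angular_quartic; have := cos2Dsin2 t.
set x := cos t; set y := sin t; move=> xy.
transitivity ((a ^+ 2 + c ^+ 2) * (x ^+ 2 + y ^+ 2) ^+ 2 +
  (2 * b ^+ 2 + 4 * a * c - 2 * (a ^+ 2 + c ^+ 2)) * (x * y) ^+ 2 +
  (2 * a * b - 2 * b * c) * (x * y * (x ^+ 2 - y ^+ 2))).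
  by ring.
by rewrite xy expr1n mulr1.
Qed.

Lemma cost_tensor_quartic m (A : 'I_m -> tensor3 R n) :
  givens_quartic (cost_tensor A).
Proof.
apply: givens_quartic_sum => l.
apply: (@givens_quartic_columns (fun v =>
  (\sum_p \sum_q \sum_r A l p q r * v p * v q * v r) ^+ 2)) => v w.
apply: (@binary_cubic_angular (fun x y => \sum_p \sum_q \sum_r A l p q r *
  (x * v p + y * w p) * (x * v q + y * w q) * (x * v r + y * w r))).
do 3!apply: binary_cubic_sum => ?.
set a := A l _ _ _; set v1 := v _; set v2 := v _; set v3 := v _.
set w1 := w _; set w2 := w _; set w3 := w _.
exists (a * v1 * v2 * v3),
  (a * (v1 * v2 * w3 + v1 * w2 * v3 + w1 * v2 * v3)),
  (a * (v1 * w2 * w3 + w1 * v2 * w3 + w1 * w2 * v3)), (a * w1 * w2 * w3).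
move=> x y; ring.
Qed.

Lemma cost_matrixE m (A : 'I_m -> 'M[R]_n) : cost_matrix A =
  fun Q => \sum_l \sum_j (\sum_q \sum_p Q p j * A l p q * Q q j) ^+ 2.
Proof.
apply/funext => Q.
apply: eq_bigr => l _; rewrite sqr_frob_norm /frob_dot big_ord1.
apply: eq_bigr => j _; rewrite -expr2 !mxE; congr (_ ^+ 2).
apply: eq_bigr => q _; rewrite mxE mulr_suml.
by apply: eq_bigr => p _; rewrite mxE.
Qed.

Lemma cost_matrix_quartic m (A : 'I_m -> 'M[R]_n) :
  givens_quartic (cost_matrix A).
Proof.
rewrite cost_matrixE.
apply: givens_quartic_sum => l.
apply: (@givens_quartic_columns (fun v =>
  (\sum_q \sum_p v p * A l p q * v q) ^+ 2)) => v w.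
apply: (@binary_quadratic_angular (fun x y => \sum_q \sum_p
  (x * v p + y * w p) * A l p q * (x * v q + y * w q))).
apply: binary_quadratic_sum => q; apply: binary_quadratic_sum => p.
exists (v p * A l p q * v q), (v p * A l p q * w q + w p * A l p q * v q),
  (w p * A l p q * w q).
by move=> x y; ring.
Qed.

Lemma cost_tensor_polyfun m (A : 'I_m -> tensor3 R n) :
  polyfun (@entry R n) (cost_tensor A).
Proof.
have pe i j : polyfun (@entry R n) (fun Q => Q i j).
  exact: (polyfun_coord (@entry R n) (i, j)).
apply: polyfun_sum => l _; apply: polyfun_sum => j _; apply: polyfunX.
do 3!apply: polyfun_sum => ? _.
by do 3!apply: polyfunM => //; exact: polyfun_const.
Qed.

Lemma cost_matrix_polyfun m (A : 'I_m -> 'M[R]_n) :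
  polyfun (@entry R n) (cost_matrix A).
Proof.
have pe i j : polyfun (@entry R n) (fun Q => Q i j).
  exact: (polyfun_coord (@entry R n) (i, j)).
rewrite cost_matrixE.
apply: polyfun_sum => l _; apply: polyfun_sum => j _; apply: polyfunX.
do 2!apply: polyfun_sum => ? _.
by do 2!apply: polyfunM => //; exact: polyfun_const.
Qed.

End CostFunctions.

Theorem theorem5p6 (R : realType) (n m : nat) (f : 'M[R]_n -> R)
    (eps : R) (Q0 : 'M[R]_n) (Q : nat -> 'M[R]_n) :
  (2 <= n)%N -> (1 <= m)%N ->
  (exists2 A : 'I_m -> tensor3 R n,
     (forall l, symmetric3 (A l)) & f = cost_tensor A) \/
  (exists2 A : 'I_m -> 'M[R]_n,
     (forall l, (A l)^T = A l) & f = cost_matrix A) ->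
  0 < eps <= 2 / n%:R ->
  SOn Q0 ->
  jacobiG f eps Q0 Q ->
  exists Qs : 'M[R]_n, [/\ Q @ \oo --> Qs, On Qs & stationary f Qs].
Proof.
move=> _ _ fE /andP[eps0 _] [oQ0 _].
suff [pf qf] : polyfun (@entry R n) f /\ givens_quartic f by exact: jacobiG_cvg.
case: fE => [[A _ ->]|[A _ ->]]; split.
- exact: cost_tensor_polyfun.
- exact: cost_tensor_quartic.
- exact: cost_matrix_polyfun.
- exact: cost_matrix_quartic.
Qed.
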